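(* Let $(A,\rho,[\cdot,\cdot])$ be a Lie algebroid on a smooth manifold $M$, let $(\Pi,\xi)$ be a Jacobi structure on it, and let $\lambda\in\Gamma(A^\star)$ satisfy $$\mathcal{L}^\rho_\xi\alpha=[\lambda,\alpha]^\lambda_{\Pi,\xi}\qquad\text{for all }\alpha\in\Gamma(A^\star).$$ Then $(A^\star,\rho_{\Pi,\xi},[\cdot,\cdot]^\lambda_{\Pi,\xi})$ is a Lie algebroid.
   Context: A Lie algebroid on $M$ is a vector bundle $A\to M$ with a vector bundle morphism $\rho:A\to TM$ (the anchor) and a skew-symmetric $\mathbb{R}$-bilinear bracket on $\Gamma(A)$ satisfying $[a,\varphi b]=\varphi[a,b]+(\rho(a)\cdot\varphi)b$ for $\varphi\in C^\infty(M)$ and the Jacobi identity. Lie derivative: $\mathcal{L}^\rho_a\varphi=\rho(a)\cdot\varphi$, $(\mathcal{L}^\rho_a\eta)(a_1,\dots,a_k)=\rho(a)\cdot\eta(a_1,\dots,a_k)-\sum_i\eta(a_1,\dots,[a,a_i],\dots,a_k)$ for $\eta\in\Gamma(\wedge^kA^\star)$, and $\langle\mathcal{L}^\rho_aP,\eta\rangle=\rho(a)\cdot\langle P,\eta\rangle-\langle P,\mathcal{L}^\rho_a\eta\rangle$ for multivector fields $P$. For a function $\varphi$, $d_\rho\varphi(a)=\rho(a)\cdot\varphi$. The Schouten–Nijenhuis bracket on $\Gamma(\wedge^\bullet A)$ is the unique $\mathbb{R}$-bilinear bracket with $[\varphi,\psi]=0$ for functions, $[a,P]=\mathcal{L}^\rho_aP$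 for $a\in\Gamma(A)$, $[P,Q]=(-1)^{kl}[Q,P]$ and $[P,Q\wedge R]=[P,Q]\wedge R+(-1)^{(k+1)l}Q\wedge[P,R]$ for $P\in\Gamma(\wedge^kA)$, $Q\in\Gamma(\wedge^lA)$. Exterior products are normalised so that $(\xi\wedge\Pi)(\alpha,\beta,\gamma)=\alpha(\xi)\Pi(\beta,\gamma)+\beta(\xi)\Pi(\gamma,\alpha)+\gamma(\xi)\Pi(\alpha,\beta)$. A pair $(\Pi,\xi)$ with $\Pi\in\Gamma(\wedge^2A)$, $\xi\in\Gamma(A)$ is a Jacobi structure if $[\Pi,\Pi]=2\xi\wedge\Pi$ and $\mathcal{L}^\rho_\xi\Pi=0$. $\sharp_\Pi:A^\star\to A$ is defined by $\beta(\sharp_\Pi(\alpha))=\Pi(\alpha,\beta)$; the Koszul bracket is $[\alpha,\beta]_\Pi=\mathcal{L}^\rho_{\sharp_\Pi(\alpha)}\beta-\mathcal{L}^\rho_{\sharp_\Pi(\beta)}\alpha-d_\rho(\Pi(\alpha,\beta))$; $\sharp_{\Pi,\xi}(\alpha)=\sharp_\Pi(\alpha)+\alpha(\xi)\xi$; $\rho_{\Pi,\xi}=\rho\circ\sharp_{\Pi,\xi}$; and $$[\alpha,\beta]^\lambda_{\Pi,\xi}=[\alpha,\beta]_\Pi+\alpha(\xi)(\mathcal{L}^\rho_\xi\beta-\beta)-\beta(\xi)(\mathcal{L}^\rho_\xi\alpha-\alpha)-\Pi(\alpha,\beta)\lambda.$$ *)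

(* Defs.v *)
From HB Require Import structures.
From mathcomp Require Import all_boot all_order all_algebra.
From mathcomp Require Import boolp classical_sets reals topology normedtype derive.

Set Implicit Arguments.
Unset Strict Implicit.
Unset Printing Implicit Defensive.
Import Order.TTheory GRing.Theory Num.Theory.
Import numFieldNormedType.Exports.

Local Open Scope classical_set_scope.
Local Open Scope ring_scope.

(* Only used with [U] open, so that the partial derivatives at the points of
   [U] depend on the values of [f] on [U] only. *)
Fixpoint Ck (R : realType) (n k : nat) (U : set 'rV[R]_n) (f : 'rV[R]_n -> R)
    : Prop :=
  (forall y, U y -> {for y, continuous f}) /\
  match k with
  | 0 => True
  | k'.+1 => forall i : 'I_n,
      (forall y, U y -> derivable f y (delta_mx 0 i)) /\
      Ck k' U (fun y => 'D_(delta_mx 0 i) f y)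
  end.

Definition Cinfty (R : realType) (n : nat) (U : set 'rV[R]_n)
    (f : 'rV[R]_n -> R) : Prop := forall k, Ck k U f.

Record chart (R : realType) (M : Type) (n : nat) := Chart {
  cdom : set M;
  cmap : M -> 'rV[R]_n;
  cinv : 'rV[R]_n -> M
}.

Definition is_chart (R : realType) (M : topologicalType) (n : nat)
    (c : chart R M n) : Prop :=
  [/\ open (cdom c), open (cmap c @` cdom c),
      forall x, cdom c x -> cinv c (cmap c x) = x,
      forall x, cdom c x -> {for x, continuous (cmap c)} &
      forall y, (cmap c @` cdom c) y -> {for y, continuous (cinv c)}].

Definition chart_compat (R : realType) (M : Type) (n : nat)
    (c c' : chart R M n) : Prop :=
  forall j : 'I_n, Cinfty (cmap c @` (cdom c `&` cdom c'))
                          (fun y => cmap c' (cinv c y) 0 j).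

Record manifold (R : realType) := Manifold {
  mtop :> topologicalType;
  mdim : nat;
  atlas : set (chart R mtop mdim);
  manifold_hausdorff : hausdorff_space mtop;
  manifold_second_countable : @second_countable mtop;
  atlas_chart : forall c, atlas c -> is_chart c;
  atlas_cover : forall x : mtop, exists2 c, atlas c & cdom c x;
  atlas_compat : forall c c', atlas c -> atlas c' -> chart_compat c c'
}.

(* [U] is meant to be open. *)
Definition smooth_on (R : realType) (M : manifold R) (U : set M) (f : M -> R)
    : Prop :=
  forall c, atlas c -> Cinfty (cmap c @` (cdom c `&` U)) (fun y => f (cinv c y)).

Definition smooth (R : realType) (M : manifold R) (f : M -> R) : Prop :=
  smooth_on [set: M] f.

(* The tangent space at [x] consists of the derivations at [x] of C^oo(M); a
   derivation is represented by a functional on all functions, of which only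
   the restriction to smooth functions matters. *)
Definition is_tangent (R : realType) (M : manifold R) (x : M)
    (D : (M -> R) -> R) : Prop :=
  (forall (r : R) f g, smooth f -> smooth g ->
     D (fun y => r * f y + g y) = r * D f + D g) /\
  (forall f g, smooth f -> smooth g ->
     D (fun y => f y * g y) = f x * D g + g x * D f).

Record triv (R : realType) (M : Type) (r : nat) (E : M -> vectType R) := Triv {
  tdom : set M;
  tmap : forall x, 'Hom(E x, 'rV[R]_r);
  tinv : forall x, 'Hom('rV[R]_r, E x)
}.

Definition frame (R : realType) (M : Type) (r : nat) (E : M -> vectType R)
    (t : triv r E) (i : 'I_r) (x : M) : E x := tinv t x (delta_mx 0 i).

(* A vector bundle is given by its fibres and a bundle atlas: local
   trivialisations [tmap t x : E x -> R^r] that are linear isomorphisms for [x]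
   in the open set [tdom t], with smooth transition matrices. *)
Record vector_bundle (R : realType) (M : manifold R) := VectorBundle {
  fiber :> M -> vectType R;
  rank : nat;
  trivs : set (triv rank fiber);
  triv_open : forall t, trivs t -> open (tdom t);
  triv_cover : forall x : M, exists2 t, trivs t & tdom t x;
  tmapK : forall t x, trivs t -> tdom t x -> cancel (tmap t x) (tinv t x);
  tinvK : forall t x, trivs t -> tdom t x -> cancel (tinv t x) (tmap t x);
  triv_compat : forall t t' (i j : 'I_rank), trivs t -> trivs t' ->
    smooth_on (tdom t `&` tdom t') (fun x => tmap t' x (frame t i x) 0 j)
}.

Definition sect (R : realType) (M : manifold R) (E : vector_bundle M) :=
  forall x : M, E x.

Definition smooth_sect (R : realType) (M : manifold R) (E : vector_bundle M)
    (s : sect E) : Prop :=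
  forall t (j : 'I_(rank E)), trivs t ->
    smooth_on (tdom t) (fun x => tmap t x (s x) 0 j).

Definition dual_fiber (R : realType) (M : Type) (E : M -> vectType R) (x : M)
    : vectType R := 'Hom(E x, R^o).

Definition dual_triv (R : realType) (M : Type) (r : nat) (E : M -> vectType R)
    (t : triv r E) : triv r (dual_fiber E) :=
  {| tdom := tdom t;
     tmap := fun x => linfun (fun al : 'Hom(E x, R^o) =>
               \row_(i < r) (al (frame t i x) : R));
     tinv := fun x => linfun (fun w : 'rV[R]_r =>
               (linfun (fun u : E x =>
                  (\sum_(i < r) w 0 i * tmap t x u 0 i : R^o)) : 'Hom(E x, R^o)))
  |}.

Lemma dual_tmapE (R : realType) (M : Type) (r : nat) (E : M -> vectType R)
    (t : triv r E) (x : M) (al : 'Hom(E x, R^o)) :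
  tmap (dual_triv t) x al = \row_(i < r) (al (frame t i x) : R).
Proof.
pose f (b : 'Hom(E x, R^o)) := \row_(i < r) (b (frame t i x) : R).
have fL : linear f.
  by move=> c u v; apply/rowP => i; rewrite !mxE add_lfunE scale_lfunE.
pose fl := GRing.isLinear.Build R _ _ _ f fL.
pose F : {linear 'Hom(E x, R^o) -> 'rV[R]_r} := HB.pack f fl.
exact: (lfunE F al).
Qed.

Lemma dual_tinvE (R : realType) (M : Type) (r : nat) (E : M -> vectType R)
    (t : triv r E) (x : M) (w : 'rV[R]_r) (u : E x) :
  (tinv (dual_triv t) x w : 'Hom(E x, R^o)) u
  = \sum_(i < r) w 0 i * tmap t x u 0 i.
Proof.
pose g (w : 'rV[R]_r) (u : E x) : R^o := \sum_(i < r) w 0 i * tmap t x u 0 i.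
have gL w' : linear (g w').
  move=> c u1 u2; rewrite /g scaler_sumr -big_split; apply: eq_bigr => i _.
  by rewrite linearP !mxE mulrDr mulrCA.
have gE w' u' : linfun (g w') u' = g w' u'.
  pose G : {linear E x -> R^o} := HB.pack (g w') (GRing.isLinear.Build R _ _ _ _ (gL w')).
  exact: (lfunE G u').
pose h (w : 'rV[R]_r) : 'Hom(E x, R^o) := linfun (g w).
have hL : linear h.
  move=> c w1 w2; apply/lfunP => v; rewrite add_lfunE scale_lfunE !gE /g.
  rewrite scaler_sumr -big_split; apply: eq_bigr => i _.
  by rewrite !mxE mulrDl -mulrA.
pose H : {linear 'rV[R]_r -> 'Hom(E x, R^o)} :=
  HB.pack h (GRing.isLinear.Build R _ _ _ _ hL).
by rewrite -[RHS]/(g w u) -gE; congr (fun_of_lfun _ u); exact: (lfunE H w).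
Qed.

Lemma dual_triv_open (R : realType) (M : manifold R) (E : vector_bundle M) t :
  (@dual_triv R M (rank E) E @` @trivs R M E) t -> open (tdom t).
Proof. by case=> t0 /triv_open ? <-. Qed.

Lemma dual_triv_cover (R : realType) (M : manifold R) (E : vector_bundle M)
    (x : M) :
  exists2 t, (@dual_triv R M (rank E) E @` @trivs R M E) t & tdom t x.
Proof. by have [t At tx] := triv_cover E x; exists (dual_triv t) => //; exists t. Qed.

Lemma dual_tmapK (R : realType) (M : manifold R) (E : vector_bundle M) t
    (x : M) :
  (@dual_triv R M (rank E) E @` @trivs R M E) t -> tdom t x ->
  cancel (tmap t x) (tinv t x).
Proof.
case=> t0 At <- tx al; apply/lfunP => u; rewrite dual_tinvE dual_tmapE.
rewrite -[u in RHS](tmapK At tx) {2}(row_sum_delta (tmap t0 x u)) !linear_sum.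
by apply: eq_bigr => i _; rewrite mxE !linearZ /= mulrC.
Qed.

Lemma dual_tinvK (R : realType) (M : manifold R) (E : vector_bundle M) t
    (x : M) :
  (@dual_triv R M (rank E) E @` @trivs R M E) t -> tdom t x ->
  cancel (tinv t x) (tmap t x).
Proof.
case=> t0 At <- tx w; rewrite dual_tmapE; apply/rowP => i; rewrite mxE dual_tinvE.
rewrite /frame (tinvK At tx) (bigD1 i) //= mxE !eqxx mulr1 big1 ?addr0 // => j ji.
by rewrite mxE eqxx (negbTE ji) mulr0.
Qed.

Lemma dual_triv_compat (R : realType) (M : manifold R) (E : vector_bundle M)
    t t' (i j : 'I_(rank E)) :
  (@dual_triv R M (rank E) E @` @trivs R M E) t ->
  (@dual_triv R M (rank E) E @` @trivs R M E) t' ->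
  smooth_on (tdom t `&` tdom t') (fun x => tmap t' x (frame t i x) 0 j).
Proof.
case=> t0 At <- [t1 At'] <- /=; rewrite setIC.
have -> : (fun x => tmap (dual_triv t1) x (frame (dual_triv t0) i x) 0 j)
        = (fun x => tmap t0 x (frame t1 j x) 0 i).
  apply/funext => x; rewrite dual_tmapE mxE dual_tinvE (bigD1 i) //= mxE !eqxx.
  by rewrite mul1r big1 ?addr0 // => k ki; rewrite mxE eqxx (negbTE ki) mul0r.
exact: triv_compat.
Qed.

Definition dual_bundle (R : realType) (M : manifold R) (E : vector_bundle M)
    : vector_bundle M :=
  {| fiber := dual_fiber E;
     rank := rank E;
     trivs := @dual_triv R M (rank E) E @` @trivs R M E;
     triv_open := @dual_triv_open R M E;
     triv_cover := @dual_triv_cover R M E;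
     tmapK := @dual_tmapK R M E;
     tinvK := @dual_tinvK R M E;
     triv_compat := @dual_triv_compat R M E |}.

Definition anchor_map (R : realType) (M : manifold R) (E : vector_bundle M) :=
  forall x : M, E x -> (M -> R) -> R.

Definition sect_bracket (R : realType) (M : manifold R) (E : vector_bundle M) :=
  sect E -> sect E -> sect E.

Definition app_anchor (R : realType) (M : manifold R) (E : vector_bundle M)
    (rho : anchor_map E) (a : sect E) (f : M -> R) : M -> R :=
  fun x => rho x (a x) f.

(* A morphism of vector bundles E -> TM: fibrewise linear and smooth. A vector
   field along an open set is smooth iff it maps the smooth functions on M to
   smooth functions; smoothness of the morphism asks this of the images of the
   local frames. *)
Record is_anchor (R : realType) (M : manifold R) (E : vector_bundle M)
    (rho : anchor_map E) : Prop := IsAnchor {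
  anchor_tangent : forall x (v : E x), is_tangent x (rho x v);
  anchor_linear : forall x (r : R) (u v : E x) f, smooth f ->
    rho x (r *: u + v) f = r * rho x u f + rho x v f;
  anchor_smooth : forall t (i : 'I_(rank E)) f, trivs t -> smooth f ->
    smooth_on (tdom t) (fun x => rho x (frame t i x) f)
}.

(* A bracket on Gamma(E) is given by an operation on all (set-theoretic)
   sections, of which only the restriction to smooth sections matters. *)
Record lie_algebroid (R : realType) (M : manifold R) (E : vector_bundle M)
    (rho : anchor_map E) (br : sect_bracket E) : Prop := LieAlgebroid {
  la_anchor : is_anchor rho;
  la_smooth : forall a b, smooth_sect a -> smooth_sect b -> smooth_sect (br a b);
  la_linearl : forall (r : R) a a' b,
    smooth_sect a -> smooth_sect a' -> smooth_sect b ->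
    forall x, br (fun y => r *: a y + a' y) b x = r *: br a b x + br a' b x;
  la_linearr : forall (r : R) a b b',
    smooth_sect a -> smooth_sect b -> smooth_sect b' ->
    forall x, br a (fun y => r *: b y + b' y) x = r *: br a b x + br a b' x;
  la_skew : forall a b, smooth_sect a -> smooth_sect b ->
    forall x, br a b x = - br b a x;
  la_leibniz : forall a b (f : M -> R),
    smooth_sect a -> smooth_sect b -> smooth f ->
    forall x, br a (fun y => f y *: b y) x
              = f x *: br a b x + app_anchor rho a f x *: b x;
  la_jacobi : forall a b c, smooth_sect a -> smooth_sect b -> smooth_sect c ->
    forall x, br a (br b c) x + br b (br c a) x + br c (br a b) x = 0
}.

(* An alternating [k]-linear form is encoded as a function on sequences that
   vanishes on the sequences of length other than [k]; this avoids casts between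
   degrees such as [k + l.+1] and [(k + l).+1]. *)
Definition alt_form (R : realType) (k : nat) (V : vectType R)
    (P : seq V -> R) : Prop :=
  [/\ forall s, size s <> k -> P s = 0,
      forall s1 s2 (r : R) (u v : V),
        P (s1 ++ (r *: u + v) :: s2) = r * P (s1 ++ u :: s2) + P (s1 ++ v :: s2) &
      forall s, ~~ uniq s -> P s = 0].

Definition tensor (R : realType) (M : manifold R) (E : vector_bundle M) :=
  forall x : M, seq (E x) -> R.

(* [is_form k eta], for [eta : tensor E], says that [eta] is a smooth section of
   the k-th exterior power of the dual of [E].  Elements of
   [Lambda^k A] are identified with alternating [k]-linear forms on the dual
   fibres, so that [is_form k P], for [P : tensor (dual_bundle A)], says that [P]
   is a multivector field of degree [k]. *)
Definition is_form (R : realType) (M : manifold R) (E : vector_bundle M)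
    (k : nat) (P : tensor E) : Prop :=
  (forall x, alt_form k (P x)) /\
  (forall t (I : seq 'I_(rank E)), trivs t ->
     smooth_on (tdom t) (fun x => P x [seq frame t i x | i <- I])).

Definition of_fun (R : realType) (M : manifold R) (E : vector_bundle M)
    (f : M -> R) : tensor E := fun x s => if s is [::] then f x else 0.
Arguments of_fun {R M E} f x s.

Definition of_form (R : realType) (M : manifold R) (A : vector_bundle M)
    (al : sect (dual_bundle A)) : tensor A :=
  fun x s => if s is [:: v] then (al x : 'Hom(A x, R^o)) v else 0.
Arguments of_form {R M A} al x s.

Definition of_sect (R : realType) (M : manifold R) (A : vector_bundle M)
    (a : sect A) : tensor (dual_bundle A) :=
  fun x s => if s is [:: al] then (al : 'Hom(A x, R^o)) (a x) else 0.
Arguments of_sect {R M A} a x s.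

(* All ways [(b, s1, s2)] to split [s] into two complementary subsequences, [b]
   being the parity of the permutation taking [s] to [s1 ++ s2]. *)
Fixpoint unshuffles (V : Type) (s : seq V) : seq (bool * seq V * seq V) :=
  if s is v :: s' then
    [seq (p.1.1, v :: p.1.2, p.2) | p <- unshuffles s'] ++
    [seq (p.1.1 (+) odd (size p.1.2), p.1.2, v :: p.2) | p <- unshuffles s']
  else [:: (false, [::], [::])].

(* On forms of degrees [k] and [l], this is [1 / (k! l!)] times the sum of
   [sgn sigma P(v_sigma(1), ...) Q(v_sigma(k+1), ...)] over all permutations;
   see [wedge_sect2]. *)
Definition wedge (R : realType) (M : manifold R) (E : vector_bundle M)
    (P Q : tensor E) : tensor E :=
  fun x s => \sum_(p <- unshuffles s) (-1) ^+ p.1.1 * P x p.1.2 * Q x p.2.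
Arguments wedge {R M E} P Q x s.

Lemma wedge_sect2 (R : realType) (M : manifold R) (A : vector_bundle M)
    (xi : sect A) (Pi : tensor (dual_bundle A)) (x : M) (al be ga : dual_bundle A x) :
  is_form 2 Pi ->
  wedge (of_sect xi) Pi x [:: al; be; ga]
  = (al : 'Hom(A x, R^o)) (xi x) * Pi x [:: be; ga]
    + (be : 'Hom(A x, R^o)) (xi x) * Pi x [:: ga; al]
    + (ga : 'Hom(A x, R^o)) (xi x) * Pi x [:: al; be].
Proof.
case=> /(_ x)[_ lin alt] _.
have skew u v : Pi x [:: u; v] = - Pi x [:: v; u].
  have D p q w : Pi x [:: p + q; w] = Pi x [:: p; w] + Pi x [:: q; w].
    by have := lin [::] [:: w] 1 p q; rewrite /= scale1r mul1r.
  have Dr p q w : Pi x [:: w; p + q] = Pi x [:: w; p] + Pi x [:: w; q].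
    by have := lin [:: w] [::] 1 p q; rewrite /= scale1r mul1r.
  have Z w : Pi x [:: w; w] = 0 by apply: alt; rewrite /= inE eqxx.
  by have := Z (u + v); rewrite D !Dr !Z add0r addr0 => /eqP; rewrite addr_eq0 => /eqP.
rewrite /wedge /= !big_cons big_nil /= !expr0 !expr1 !mul1r !mul0r !mulr0 !mul0r.
rewrite !add0r !addr0 (skew ga al) mulrN !mulN1r !mulNr ?mul1r.
by rewrite addrA.
Qed.

(* The pairing of [Lambda^k V] with [Lambda^k (dual V)], normalised so that
   [<P, al_1 /\ ... /\ al_k> = P(al_1, ..., al_k)], computed in a basis. *)
Definition pairing (R : realType) (k : nat) (V : vectType R)
    (P : seq 'Hom(V, R^o) -> R) (eta : seq V -> R) : R :=
  (k`!%:R)^-1 * \sum_(I : k.-tuple 'I_(\dim {:V}))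
     P [seq linfun (coord (vbasis {:V}) i) | i <- I]
     * eta [seq tnth (vbasis {:V}) i | i <- I].

Definition lie_form_eval (R : realType) (M : manifold R) (A : vector_bundle M)
    (rho : anchor_map A) (br : sect_bracket A) (a : sect A) (eta : tensor A)
    (bs : seq (sect A)) : M -> R :=
  fun x =>
    app_anchor rho a (fun y => eta y [seq b y | b <- bs]) x
    - \sum_(i < size bs)
        eta x [seq b x | b <- set_nth a bs i (br a (nth a bs i))].

(* The value of [L_a eta] on vectors of the fibre at [x] is the value at [x] of
   the defining formula on any smooth sections through these vectors. *)
Definition lie_form (R : realType) (M : manifold R) (A : vector_bundle M)
    (rho : anchor_map A) (br : sect_bracket A) (a : sect A) (eta : tensor A)
    : tensor A :=
  fun x s => xget 0 [set r | exists bs : seq (sect A),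
    [/\ forall i, (i < size bs)%N -> smooth_sect (nth a bs i),
        [seq b x | b <- bs] = s &
        r = lie_form_eval rho br a eta bs x]].
Arguments lie_form {R M A} rho br a eta x s.

Definition lie_form1 (R : realType) (M : manifold R) (A : vector_bundle M)
    (rho : anchor_map A) (br : sect_bracket A) (a : sect A)
    (al : sect (dual_bundle A)) : sect (dual_bundle A) :=
  fun x => linfun (fun v : A x =>
             (lie_form rho br a (of_form al) x [:: v] : R^o)).

(* [P' = L_a P] for multivector fields of degree [k]. *)
Definition is_lie_mv (R : realType) (M : manifold R) (A : vector_bundle M)
    (rho : anchor_map A) (br : sect_bracket A) (k : nat) (a : sect A)
    (P P' : tensor (dual_bundle A)) : Prop :=
  forall eta : tensor A, is_form k eta -> forall x,
    pairing k (P' x) (eta x)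
    = app_anchor rho a (fun y => pairing k (P y) (eta y)) x
      - pairing k (P x) (lie_form rho br a eta x).

(* [S] is the Schouten-Nijenhuis bracket, with the sign conventions
   [P, Q] = (-1)^(kl) [Q, P] and [a, P] = L_a P. It is specified on homogeneous
   multivector fields, where these conditions determine it; its values on
   arguments that are not multivector fields are irrelevant. *)
Record schouten (R : realType) (M : manifold R) (A : vector_bundle M)
    (rho : anchor_map A) (br : sect_bracket A)
    (S : tensor (dual_bundle A) -> tensor (dual_bundle A) -> tensor (dual_bundle A)) : Prop := Schouten {
  sn_degree : forall k l P Q, is_form k P -> is_form l Q -> (0 < k + l)%N ->
    is_form (k + l).-1 (S P Q);
  sn_linearl : forall k l (r : R) P P' Q,
    is_form k P -> is_form k P' -> is_form l Q ->
    S (fun x s => r * P x s + P' x s) Q = (fun x s => r * S P Q x s + S P' Q x s);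
  sn_linearr : forall k l (r : R) P Q Q',
    is_form k P -> is_form l Q -> is_form l Q' ->
    S P (fun x s => r * Q x s + Q' x s) = (fun x s => r * S P Q x s + S P Q' x s);
  sn_fun : forall f g : M -> R, smooth f -> smooth g ->
    S (of_fun f) (of_fun g) = (fun _ _ => 0);
  sn_sect : forall k (a : sect A) P, smooth_sect a -> is_form k P ->
    is_lie_mv rho br k a P (S (of_sect a) P);
  sn_sym : forall k l P Q, is_form k P -> is_form l Q ->
    S P Q = (fun x s => (-1) ^+ (k * l) * S Q P x s);
  sn_leibniz : forall k l m P Q T, is_form k P -> is_form l Q -> is_form m T ->
    S P (wedge Q T)
    = (fun x s => wedge (S P Q) T x s
                  + (-1) ^+ ((k + 1) * l) * wedge Q (S P T) x s)
}.

(* [schouten] determines [S] uniquely on multivector fields, so the existential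
   only names the Schouten-Nijenhuis bracket. *)
Definition jacobi_structure (R : realType) (M : manifold R)
    (A : vector_bundle M) (rho : anchor_map A) (br : sect_bracket A)
    (Pi : tensor (dual_bundle A)) (xi : sect A) : Prop :=
  [/\ is_form 2 Pi,
      smooth_sect xi,
      exists2 S, schouten rho br S &
        S Pi Pi = (fun x s => 2 * wedge (of_sect xi) Pi x s) &
      is_lie_mv rho br 2 xi Pi (fun _ _ => 0)].

Definition biv (R : realType) (M : manifold R) (A : vector_bundle M)
    (Pi : tensor (dual_bundle A)) (al be : sect (dual_bundle A)) : M -> R :=
  fun x => Pi x [:: al x; be x].

Definition contract (R : realType) (M : manifold R) (A : vector_bundle M)
    (al : sect (dual_bundle A)) (a : sect A) : M -> R :=
  fun x => (al x : 'Hom(A x, R^o)) (a x).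

Definition sharp (R : realType) (M : manifold R) (A : vector_bundle M)
    (Pi : tensor (dual_bundle A)) (x : M) (al : dual_bundle A x) : A x :=
  xget 0 [set v | forall be : 'Hom(A x, R^o), be v = Pi x [:: al; be]].

Definition sharp_sect (R : realType) (M : manifold R) (A : vector_bundle M)
    (Pi : tensor (dual_bundle A)) (al : sect (dual_bundle A)) : sect A :=
  fun x => sharp Pi (al x).

Definition d_rho (R : realType) (M : manifold R) (A : vector_bundle M)
    (rho : anchor_map A) (f : M -> R) : sect (dual_bundle A) :=
  fun x => linfun (fun v : A x => (rho x v f : R^o)).

Definition koszul (R : realType) (M : manifold R) (A : vector_bundle M)
    (rho : anchor_map A) (br : sect_bracket A) (Pi : tensor (dual_bundle A))
    : sect_bracket (dual_bundle A) :=
  fun al be x =>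
    lie_form1 rho br (sharp_sect Pi al) be x
    - lie_form1 rho br (sharp_sect Pi be) al x
    - d_rho rho (biv Pi al be) x.

Definition sharp_jacobi (R : realType) (M : manifold R) (A : vector_bundle M)
    (Pi : tensor (dual_bundle A)) (xi : sect A) (x : M) (al : dual_bundle A x) : A x :=
  sharp Pi al + ((al : 'Hom(A x, R^o)) (xi x) : R) *: xi x.

Definition anchor_jacobi (R : realType) (M : manifold R) (A : vector_bundle M)
    (rho : anchor_map A) (Pi : tensor (dual_bundle A)) (xi : sect A)
    : anchor_map (dual_bundle A) :=
  fun x al => rho x (sharp_jacobi Pi xi al).

Definition bracket_jacobi (R : realType) (M : manifold R) (A : vector_bundle M)
    (rho : anchor_map A) (br : sect_bracket A) (Pi : tensor (dual_bundle A))
    (xi : sect A) (lam : sect (dual_bundle A)) : sect_bracket (dual_bundle A) :=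
  fun al be x =>
    koszul rho br Pi al be x
    + contract al xi x *: (lie_form1 rho br xi be x - be x)
    - contract be xi x *: (lie_form1 rho br xi al x - al x)
    - biv Pi al be x *: lam x.

(* Main.v *)
Require Import Defs.
From HB Require Import structures.
From mathcomp Require Import all_boot all_order all_algebra.
From mathcomp Require Import boolp classical_sets reals topology normedtype derive.
From mathcomp Require Import functions realfun sequences exp.
From mathcomp Require Import ring lra.

(** Write [alpha(xi) = <alpha, xi>], [T alpha = #alpha + alpha(xi) xi] and
    [[alpha, beta]^lambda = B(alpha, beta) - Pi(alpha, beta) lambda], so that [B]
    is free of [lambda]; like the whole bracket, [B] satisfies the Leibniz rule for
    the anchor [rho o T].  The equation for [lambda] says that bracketing
    with [lambda] is [L_xi], hence the Jacobiator of the bracket is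
      [cyc (B(alpha, B(beta, gamma)) + Pi(beta, gamma) L_xi alpha)
       - cyc (Pi(alpha, B(beta, gamma)) + rho(T alpha).Pi(beta, gamma)) lambda]
    where [cyc] is the cyclic sum.  Both cyclic sums vanish for every Jacobi
    structure ([brj0_jacobi], [biv_brj0]).  The two facts behind this are
    [[xi, #alpha] = #(L_xi alpha)], which is [L_xi Pi = 0], and
      [#[alpha, beta]_Pi = [#alpha, #beta] + alpha(xi) #beta - beta(xi) #alpha
                           + Pi(alpha, beta) xi],
    which is [[Pi, Pi] = 2 xi /\ Pi]; they give the Jacobiator
      [- cyc (alpha(xi) [beta, gamma]_Pi + Pi(beta, gamma) L_xi alpha)]
    of the Koszul bracket ([kos_jacobi]), whose first term the terms
    [alpha(xi) (L_xi beta - beta)] of [B] are made to cancel.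

    All of this is Cartan calculus: identities between sections, forms and
    functions that follow from a list of rules ([cartan]).  The geometry consists
    in showing that a Lie algebroid obeys these rules and in extracting the
    two facts from the Schouten bracket.  Lie derivatives of forms and Schouten
    brackets are known only through global smooth sections, whereas the values
    that matter are taken at a point [x].  The bridge is [global_frame]: with the
    help of bump functions, every vector [v] is [h^2 v + sum_i eps_i(v) e_i]
    for global [e_i], [eps_i] and a function [h] vanishing at [x].  The error
    [h^2 v] is invisible at [x] to operators of first order; this makes
    [L_a alpha] a tensor ([tensorial]), and it reduces [[Pi, Pi]] at [x] to
    brackets [[Pi, a /\ b] = L_a Pi /\ b - a /\ L_b Pi] ([sn_biv]).

    The rule [rho [a, b] = [rho a, rho b]] needs a section that does not vanish at
    the given point.  In rank [0] there is none, but then all the identities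
    to prove hold in zero fibres. *)

Set Implicit Arguments.
Unset Strict Implicit.
Unset Printing Implicit Defensive.
Import Order.TTheory GRing.Theory Num.Theory.
Import numFieldNormedType.Exports.

Local Open Scope classical_set_scope.
Local Open Scope ring_scope.

(** * Cartan calculus over a commutative ring *)

(** [G] stands for the sections of a Lie algebroid, [O] for those of its dual and [F]
    for the functions.  Both modules are separated by the pairing, so that
    identities in them can be proved in [F], after evaluation. *)
Record cartan (F : comPzRingType) (G O : lmodType F) := Cartan {
  ev : O -> G -> F;
  act : G -> F -> F;
  lbr : G -> G -> G;
  lie : G -> O -> O;
  dif : F -> O;
  evDl : forall al be s, ev (al + be) s = ev al s + ev be s;
  evZl : forall f al s, ev (f *: al) s = f * ev al s;
  evDr : forall al s t, ev al (s + t) = ev al s + ev al t;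
  evZr : forall al f s, ev al (f *: s) = f * ev al s;
  ev_injl : forall al be, (forall s, ev al s = ev be s) -> al = be;
  ev_injr : forall s t, (forall al, ev al s = ev al t) -> s = t;
  actDl : forall s t f, act (s + t) f = act s f + act t f;
  actZl : forall g s f, act (g *: s) f = g * act s f;
  actD : forall s f g, act s (f + g) = act s f + act s g;
  actM : forall s f g, act s (f * g) = f * act s g + g * act s f;
  lbrDr : forall s t u, lbr s (t + u) = lbr s t + lbr s u;
  lbrC : forall s t, lbr s t = - lbr t s;
  lbrss : forall s, lbr s s = 0;
  lbrZr : forall s f t, lbr s (f *: t) = f *: lbr s t + act s f *: t;
  lbr_jacobi : forall s t u, lbr s (lbr t u) + lbr t (lbr u s) + lbr u (lbr s t) = 0;
  act_lbr : forall s t f, act (lbr s t) f = act s (act t f) - act t (act s f);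
  ev_lie : forall s al t, ev (lie s al) t = act s (ev al t) - ev al (lbr s t);
  ev_dif : forall f s, ev (dif f) s = act s f
}.

(** Derives an identity of ring elements from another one: the remaining goal is an
    identity that [ring] decides. *)
Lemma eq_of_subr (V : zmodType) (x y z w : V) : z = w -> x - y = z - w -> x = y.
Proof. by move=> ->; rewrite subrr => /eqP; rewrite subr_eq0 => /eqP. Qed.

Section Cartan.
Context (F : comPzRingType) (G O : lmodType F) (C : cartan G O).
Implicit Types (f g h : F) (r s t u X Y : G) (al be ga : O).
Local Notation ev := (ev C).
Local Notation act := (act C).
Local Notation lbr := (lbr C).
Local Notation lie := (lie C).
Local Notation dif := (dif C).

Lemma evNl al s : ev (- al) s = - ev al s.
Proof. by rewrite -scaleN1r evZl mulN1r. Qed.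

Lemma evNr al s : ev al (- s) = - ev al s.
Proof. by rewrite -scaleN1r evZr mulN1r. Qed.

Lemma ev0l s : ev 0 s = 0.
Proof. by rewrite -(scale0r 0) evZl mul0r. Qed.

Lemma act0 s : act s 0 = 0.
Proof. by apply: (addrI (act s 0)); rewrite -actD !addr0. Qed.

Lemma actN s f : act s (- f) = - act s f.
Proof. by apply: (addrI (act s f)); rewrite -actD !subrr act0. Qed.

Lemma actNl s f : act (- s) f = - act s f.
Proof. by rewrite -scaleN1r actZl mulN1r. Qed.

Lemma lbrDl s t u : lbr (s + t) u = lbr s u + lbr t u.
Proof. by rewrite (lbrC C) lbrDr opprD -!(lbrC C _ u). Qed.

Lemma lbrZl f s t : lbr (f *: s) t = f *: lbr s t - act t f *: s.
Proof. by rewrite (lbrC C) lbrZr opprD -scalerN -(lbrC C). Qed.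

Lemma lbrNr s t : lbr s (- t) = - lbr s t.
Proof.
have z : lbr s 0 = 0 by apply: (addrI (lbr s 0)); rewrite -lbrDr !addr0.
by apply: (addrI (lbr s t)); rewrite -lbrDr !subrr z.
Qed.

Lemma lbrNl s t : lbr (- s) t = - lbr s t.
Proof. by rewrite (lbrC C) lbrNr opprK -(lbrC C). Qed.

Definition evE := (evDl, evZl, evNl, evDr, evZr, evNr, ev_lie, ev_dif).
Definition actE := (actDl, actZl, actNl, actD, actM, actN).
Definition lbrE := (lbrDl, lbrZl, lbrNl, lbrDr, lbrZr, lbrNr).

Lemma lieD s al be : lie s (al + be) = lie s al + lie s be.
Proof. by apply: (ev_injl (c := C)) => t; rewrite !(evE, actE); ring. Qed.

Lemma lieN s al : lie s (- al) = - lie s al.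
Proof. by apply: (ev_injl (c := C)) => t; rewrite !(evE, actE); ring. Qed.

Lemma lieZ s f al : lie s (f *: al) = f *: lie s al + act s f *: al.
Proof. by apply: (ev_injl (c := C)) => t; rewrite !(evE, actE); ring. Qed.

Lemma lieDl s t al : lie (s + t) al = lie s al + lie t al.
Proof. by apply: (ev_injl (c := C)) => u; rewrite !(evE, actE, lbrE); ring. Qed.

Lemma lieNl s al : lie (- s) al = - lie s al.
Proof. by apply: (ev_injl (c := C)) => u; rewrite !(evE, actE, lbrE); ring. Qed.

Lemma lieZl f s al : lie (f *: s) al = f *: lie s al + ev al s *: dif f.
Proof. by apply: (ev_injl (c := C)) => u; rewrite !(evE, actE, lbrE); ring. Qed.

(** Besides the Jacobi identity this uses that the anchor is a morphism. *)
Lemma lie_lbr s t al : lie (lbr s t) al = lie s (lie t al) - lie t (lie s al).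
Proof.
apply: (ev_injl (c := C)) => u.
have J : ev al (lbr (lbr s t) u) = ev al (lbr s (lbr t u)) - ev al (lbr t (lbr s u)).
  rewrite -evNr -evDr (lbrC C (lbr s t)) -[lbr s (lbr t u)](addrK (lbr t (lbr u s))).
  rewrite -[X in _ = ev al (X - _ - _)](addrK (lbr u (lbr s t))) lbr_jacobi sub0r.
  by rewrite (lbrC C s u) lbrNr addrK.
by rewrite !(evE, actE, act_lbr, J); ring.
Qed.

Lemma lie_dif s f : lie s (dif f) = dif (act s f).
Proof.
by apply: (ev_injl (c := C)) => u; rewrite !(evE, actE, act_lbr); ring.
Qed.

Lemma difD f g : dif (f + g) = dif f + dif g.
Proof. by apply: (ev_injl (c := C)) => u; rewrite !(evE, actE). Qed.

Lemma difN f : dif (- f) = - dif f.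
Proof. by apply: (ev_injl (c := C)) => u; rewrite !(evE, actE). Qed.

Definition lieE := (lieD, lieN, lieZ, lieDl, lieNl, lieZl, lie_lbr, lie_dif).

(** * The Schouten bracket of bivectors *)

(** A bivector is encoded by the map [q] it induces from forms to sections. *)
Definition skew_map (q : O -> G) := forall al be, ev be (q al) = - ev al (q be).

(** The Schouten bracket of the bivectors [p] and [q], polarised from
    [[p, p](al, be, ga) = 2 cyc (p(al).p(be, ga) - al [p be, p ga])].  Defining it by
    a formula makes it available before any exterior algebra. *)
Definition schouten_biv (p q : O -> G) al be ga : F :=
  let T al be ga := act (p al) (ev ga (q be)) + act (q al) (ev ga (p be))
                    - ev al (lbr (p be) (q ga)) - ev al (lbr (q be) (p ga)) in
  T al be ga + T be ga al + T ga al be.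

(** The map induced by the bivector [a /\ b]. *)
Definition wedge2 (a b : G) al : G := ev al a *: b - ev al b *: a.

(** The Lie derivative of the bivector [p] along [a], on two forms. *)
Definition lie_biv (a : G) (p : O -> G) al be : F :=
  act a (ev be (p al)) - ev be (p (lie a al)) - ev (lie a be) (p al).

(** [[p, a /\ b] = L_a p /\ b - a /\ L_b p]: both sides expand to the same
    derivatives of the pairings of the three forms with [a], [b] and the images
    of [p]. *)
Lemma schouten_biv_wedge2 p a b al be ga : skew_map p ->
  schouten_biv p (wedge2 a b) al be ga =
    (lie_biv a p al be * ev ga b - lie_biv a p al ga * ev be b
     + lie_biv a p be ga * ev al b)
    - (ev al a * lie_biv b p be ga - ev be a * lie_biv b p al ga
       + ev ga a * lie_biv b p al be).
Proof.
move=> sp; rewrite /schouten_biv /lie_biv /wedge2.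
rewrite !(sp (lie _ _)) !(evE, actE, lbrE) (sp be al) (sp ga al) (sp ga be).
rewrite !(lbrC C (p _) a) !(lbrC C (p _) b) !(evE, actE).
by ring.
Qed.

(** The bracket is a derivation of order one, so multiplying by [h^2] leaves a factor
    [h]: the result vanishes wherever [h] does. *)
Lemma schouten_biv_scale p h al be ga : skew_map p ->
  schouten_biv p (fun al => (h * h) *: p al) al be ga =
  h * (h * schouten_biv p p al be ga - 2%:R * (act (p al) h * ev ga (p be)
       + act (p be) h * ev al (p ga) + act (p ga) h * ev be (p al))).
Proof.
move=> sp; rewrite /schouten_biv !(evE, actE, lbrE).
by rewrite (sp be al) (sp ga al) (sp ga be); ring.
Qed.

Lemma schouten_bivDr p q q' al be ga :
  schouten_biv p (fun al => q al + q' al) al be ga =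
  schouten_biv p q al be ga + schouten_biv p q' al be ga.
Proof. by rewrite /schouten_biv !(evE, actE, lbrE); ring. Qed.

Lemma schouten_biv0r p al be ga : schouten_biv p (fun=> 0) al be ga = 0.
Proof.
have := schouten_bivDr p (fun=> 0) (fun=> 0) al be ga.
rewrite (_ : (fun _ : O => 0 + 0) = (fun _ : O => 0 : G)) => [|/=].
  by move/eqP; rewrite -subr_eq subrr eq_sym => /eqP.
by rewrite addr0.
Qed.

Lemma schouten_biv_diag p al be ga : let X :=
    act (p al) (ev ga (p be)) + act (p be) (ev al (p ga)) + act (p ga) (ev be (p al))
    - (ev al (lbr (p be) (p ga)) + ev be (lbr (p ga) (p al)) + ev ga (lbr (p al) (p be))) in
  schouten_biv p p al be ga = X + X.
Proof. by rewrite /schouten_biv /=; ring. Qed.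

(** * The Lie algebroid of a Jacobi pair *)

(** The last condition is [[p, p] = 2 xi /\ p], divided by two. *)
Definition jacobi_pair (p : O -> G) (xi : G) :=
  [/\ skew_map p, forall al be, lie_biv xi p al be = 0 &
    forall al be ga,
      act (p al) (ev ga (p be)) + act (p be) (ev al (p ga)) + act (p ga) (ev be (p al))
      - (ev al (lbr (p be) (p ga)) + ev be (lbr (p ga) (p al)) + ev ga (lbr (p al) (p be)))
      = ev al xi * ev ga (p be) + ev be xi * ev al (p ga) + ev ga xi * ev be (p al)].

Section Jacobi.
Context (p : O -> G) (xi : G) (lam : O) (Jp : jacobi_pair p xi).

(** The Koszul bracket. *)
Definition kos al be := lie (p al) be - lie (p be) al - dif (ev be (p al)).

(** The section [T al] through which forms act on functions. *)
Definition anc al : G := p al + ev al xi *: xi.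

(** The part of the bracket that does not involve [lam]. *)
Definition brj0 al be := kos al be + ev al xi *: (lie xi be - be)
  - ev be xi *: (lie xi al - al).

Definition brj al be := brj0 al be - ev be (p al) *: lam.

Let sp : skew_map p. Proof. by case: Jp. Qed.

Lemma sharpD al be : p (al + be) = p al + p be.
Proof. by apply: (ev_injr (c := C)) => ga; rewrite sp !evE !(sp _ ga); ring. Qed.

Lemma sharpZ f al : p (f *: al) = f *: p al.
Proof. by apply: (ev_injr (c := C)) => ga; rewrite sp !evE !(sp _ ga); ring. Qed.

Lemma sharpN al : p (- al) = - p al.
Proof. by rewrite -scaleN1r sharpZ scaleN1r. Qed.

Definition sharpE := (sharpD, sharpZ, sharpN).

Lemma kosC al be : kos be al = - kos al be.
Proof. by rewrite /kos (sp be al) difN !opprD !opprK (addrC (- lie _ _)). Qed.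

Lemma kosD al be ga : kos al (be + ga) = kos al be + kos al ga.
Proof.
by apply: (ev_injl (c := C)) => s; rewrite /kos !(sharpE, lieE, evE, actE, lbrE); ring.
Qed.

Lemma kosN al be : kos al (- be) = - kos al be.
Proof.
by apply: (ev_injl (c := C)) => s; rewrite /kos !(sharpE, lieE, evE, actE, lbrE); ring.
Qed.

Lemma kosZ al f be : kos al (f *: be) = f *: kos al be + act (p al) f *: be.
Proof.
apply: (ev_injl (c := C)) => s; rewrite /kos !(sharpE, lieE, evE, actE, lbrE).
by rewrite (sp be al); ring.
Qed.

Definition kosE := (kosD, kosN, kosZ).

(** Half of [[p, p]] measures how far [p] is from mapping the Koszul bracket to the
    bracket of sections; here it is [xi /\ p], contracted with [al] and [be]. *)
Lemma sharp_kos al be : p (kos al be) =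
  lbr (p al) (p be) + (ev al xi *: p be - ev be xi *: p al + ev be (p al) *: xi).
Proof.
have [_ _ /(_ al be) H] := Jp; apply: (ev_injr (c := C)) => ga.
apply: eq_of_subr (H ga) _; rewrite sp /kos !evE.
rewrite (sp ga be) (sp al ga) !(evE, actE).
rewrite (lbrC C (p ga) (p al)) !(evE, actE).
by ring.
Qed.

Lemma lbr_xi_sharp al : lbr xi (p al) = p (lie xi al).
Proof.
have [_ H _] := Jp; apply: (ev_injr (c := C)) => be; apply: eq_of_subr (H al be) _.
by rewrite /lie_biv evE; ring.
Qed.

Lemma act_xi_biv al be :
  act xi (ev be (p al)) = ev be (p (lie xi al)) + ev (lie xi be) (p al).
Proof.
have [_ H _] := Jp; apply: eq_of_subr (H al be) _.
by rewrite /lie_biv; ring.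
Qed.

(** [L_xi] preserves [p], hence everything that is built from [p]. *)
Lemma lie_kos al be : lie xi (kos al be) = kos (lie xi al) be + kos al (lie xi be).
Proof.
have L al' be' : lie xi (lie (p al') be') = lie (p (lie xi al')) be' + lie (p al') (lie xi be').
  by rewrite -lbr_xi_sharp lie_lbr subrK.
apply: (ev_injl (c := C)) => s.
by rewrite /kos !lieD !lieN !L lie_dif act_xi_biv difD !(evDl, evNl); ring.
Qed.

Lemma kos_xi be ga : ev (kos be ga) xi = act (p be) (ev ga xi) - act (p ga) (ev be xi).
Proof.
rewrite /kos !evE (lbrC C (p be)) (lbrC C (p ga)) !lbr_xi_sharp act_xi_biv !evNr.
by rewrite (sp (lie xi ga) be); ring.
Qed.

Lemma ev_lie_xi al : ev (lie xi al) xi = act xi (ev al xi).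
Proof. by rewrite ev_lie lbrss -(scale0r 0) evZr mul0r subr0. Qed.

(** Let [K(be, ga)] be the defect in [sharp_kos].  The Cartan rules turn the left-hand
    side into [- cyc L_(K(be, ga)) al - d (cyc (p(al).p(be, ga) + p(al, kos be ga)))].
    The last cyclic sum is [- 2 (xi /\ p)(al, be, ga)] by the quadratic condition on
    [p], and expanding [L_(K(be, ga))] produces a term that cancels it. *)
Lemma kos_jacobi al be ga :
  kos al (kos be ga) + kos be (kos ga al) + kos ga (kos al be) =
  - (ev al xi *: kos be ga + ev be xi *: kos ga al + ev ga xi *: kos al be
     + ev ga (p be) *: lie xi al + ev al (p ga) *: lie xi be
     + ev be (p al) *: lie xi ga).
Proof.
have [_ _ /(_ al be ga) H] := Jp.
apply: (ev_injl (c := C)) => s; have {H} := congr1 (act s) H.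
(* Here [p] is applied to a bracket, where [sharp_kos] can be used. *)
have E a w : kos a w = lie (p a) w - lie (p w) a + dif (ev a (p w)).
  by rewrite /kos (sp a w) difN opprK.
rewrite (E al (kos be ga)) (E be (kos ga al)) (E ga (kos al be)) !sharp_kos.
rewrite /kos !(lieE, difN, difD) !(evDl, evNl, evZl, ev_dif, evDr, evNr, evZr, actE).
rewrite (sp ga be) (sp al ga) (sp be al) !actE => H.
apply: eq_of_subr (esym H) _; ring.
Qed.

Lemma brj0D al be ga : brj0 al (be + ga) = brj0 al be + brj0 al ga.
Proof.
by apply: (ev_injl (c := C)) => s; rewrite /brj0 !(kosE, lieD) !(evDl, evNl, evZl); ring.
Qed.

Lemma brj0N al be : brj0 al (- be) = - brj0 al be.
Proof.
by apply: (ev_injl (c := C)) => s; rewrite /brj0 !(kosE, lieN) !(evDl, evNl, evZl); ring.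
Qed.

Lemma brj0Z al f be : brj0 al (f *: be) = f *: brj0 al be + act (anc al) f *: be.
Proof.
apply: (ev_injl (c := C)) => s.
by rewrite /brj0 /anc !(kosE, lieZ) !(evDl, evNl, evZl) !actE; ring.
Qed.

Lemma brjD al be ga : brj al (be + ga) = brj al be + brj al ga.
Proof.
apply: (ev_injl (c := C)) => s.
by rewrite /brj brj0D !(evDl, evNl, evZl); ring.
Qed.

Lemma brjN al be : brj al (- be) = - brj al be.
Proof.
apply: (ev_injl (c := C)) => s.
by rewrite /brj brj0N !(evDl, evNl, evZl); ring.
Qed.

Lemma brjZ al f be : brj al (f *: be) = f *: brj al be + act (anc al) f *: be.
Proof.
apply: (ev_injl (c := C)) => s.
by rewrite /brj brj0Z !(evDl, evNl, evZl); ring.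
Qed.

Lemma brjC al be : brj al be = - brj be al.
Proof.
apply: (ev_injl (c := C)) => s.
by rewrite /brj /brj0 kosC (sp be al) !(evDl, evNl, evZl); ring.
Qed.

(** The inner bracket is expanded by linearity; in the terms that remain, [brj0] is
    applied only to forms [L_xi be - be]. *)
Lemma brj0_brj0 al be ga : brj0 al (brj0 be ga) =
  kos al (kos be ga)
  + ev al xi *: (kos (lie xi be) ga + kos be (lie xi ga) - kos be ga)
  - (act (p be) (ev ga xi) - act (p ga) (ev be xi)) *: (lie xi al - al)
  + (ev be xi *: brj0 al (lie xi ga - ga) + act (anc al) (ev be xi) *: (lie xi ga - ga))
  - (ev ga xi *: brj0 al (lie xi be - be) + act (anc al) (ev ga xi) *: (lie xi be - be)).
Proof.
by rewrite [brj0 be ga]/brj0 2!brj0D brj0N 2!brj0Z [brj0 al (kos _ _)]/brj0 lie_kos kos_xi.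
Qed.

Lemma brj0_lie_sub al be : brj0 al (lie xi be - be) =
  kos al (lie xi be) - kos al be
  + ev al xi *: (lie xi (lie xi be) - lie xi be - (lie xi be - be))
  - (act xi (ev be xi) - ev be xi) *: (lie xi al - al).
Proof. by rewrite /brj0 kosD kosN lieD lieN evDl evNl ev_lie_xi. Qed.

(** In the cyclic sum the terms of second order in [L_xi] are symmetric and cancel,
    the derivatives of [al xi] cancel by [kos_xi], and what is left is the Jacobiator
    of the Koszul bracket plus [cyc (al(xi) kos be ga)]. *)
Lemma brj0_jacobi al be ga :
  brj0 al (brj0 be ga) + brj0 be (brj0 ga al) + brj0 ga (brj0 al be) =
  - (ev ga (p be) *: lie xi al + ev al (p ga) *: lie xi be + ev be (p al) *: lie xi ga).
Proof.
have J := kos_jacobi al be ga.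
rewrite !brj0_brj0 !brj0_lie_sub /anc.
have KL x y : kos x (lie xi y) = - kos (lie xi y) x by exact: kosC.
rewrite !KL.
rewrite (kosC al ga) (kosC be al) (kosC ga be) in J *.
apply: (ev_injl (c := C)) => s; have {J} := congr1 (ev ^~ s) J.
rewrite !(evDl, evNl, evZl) !actDl !actZl => H.
apply: eq_of_subr H _; ring.
Qed.

(** The coefficient of [lam] in the Jacobiator. The quadratic condition
    enters twice, through [sharp_kos] and through the derivatives of the
    pairings along the images of [p]. *)
Lemma biv_brj0 al be ga :
  (ev (brj0 be ga) (p al) + act (anc al) (ev ga (p be)))
  + (ev (brj0 ga al) (p be) + act (anc be) (ev al (p ga)))
  + (ev (brj0 al be) (p ga) + act (anc ga) (ev be (p al))) = 0.
Proof.
have [_ _ /(_ al be ga) H] := Jp.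
apply: eq_of_subr H _.
have K a b c : ev (kos a b) (p c) = - ev c (p (kos a b)) by rewrite sp.
have E a b t : ev (brj0 a b) t = ev (kos a b) t + ev a xi * (ev (lie xi b) t - ev b t)
    - ev b xi * (ev (lie xi a) t - ev a t).
  by rewrite /brj0 2!evDl evNl 2!evZl 2!evDl 2!evNl.
rewrite !E /anc !actDl !actZl !act_xi_biv !K !sharp_kos.
rewrite !(evDr, evNr, evZr) !(sp be (lie _ _)) !(sp ga (lie _ _)) !(sp al (lie _ _)).
rewrite (sp be al) (sp ga be) (sp al ga).
ring.
Qed.

(** Expanding the inner bracket by the Leibniz rule produces [brj al lam], which the
    equation for [lam] turns into [- L_xi al]. *)
Lemma brj_jacobi al be ga : (forall be, lie xi be = brj lam be) ->
  brj al (brj be ga) + brj be (brj ga al) + brj ga (brj al be) = 0.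
Proof.
move=> lamP; have L a b c : brj a (brj b c) = brj0 a (brj0 b c)
    + ev c (p b) *: lie xi a
    - (ev (brj0 b c) (p a) + act (anc a) (ev c (p b))) *: lam.
  rewrite {2}/brj brjD brjN brjZ (brjC a lam) -lamP {1}/brj.
  by apply: (ev_injl (c := C)) => s; rewrite !(evDl, evNl, evZl); ring.
have J := brj0_jacobi al be ga; have B := biv_brj0 al be ga.
apply: (ev_injl (c := C)) => s; rewrite !L; have {J} := congr1 (ev ^~ s) J.
have {B} := congr1 (fun f => f * ev lam s) B.
rewrite !(evDl, evNl, evZl) ev0l mul0r => B J.
have {J B} H := f_equal2 (fun f g : F => f - g) J B.
apply: eq_of_subr H _; ring.
Qed.

End Jacobi.
End Cartan.

(** * Functions of class C^k on open subsets of R^n *)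

Lemma near_open_eq (S : topologicalType) (T : Type) (U : set S) (f g : S -> T) y :
  open U -> (forall z, U z -> f z = g z) -> U y -> \near y, f y = g y.
Proof.
by move=> oU fg Uy; apply: filterS fg _; apply: open_nbhs_nbhs.
Qed.

Lemma open_eq_continuous (S T : topologicalType) (U : set S) (f g : S -> T) y :
  open U -> (forall z, U z -> f z = g z) -> U y ->
  {for y, continuous f} -> {for y, continuous g}.
Proof.
move=> oU fg Uy; rewrite /prop_for /continuous_at (fg _ Uy) => c.
by apply: (cvg_trans _ c); apply: near_eq_cvg; exact: near_open_eq oU fg Uy.
Qed.

Section Ck.
Context (R : realType) (n : nat).
Implicit Types (U V : set 'rV[R]_n) (f g u : 'rV[R]_n -> R).

Lemma Ck_subset k U V f : V `<=` U -> Ck k U f -> Ck k V f.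
Proof.
move=> VU; elim: k f => [|k IH] f [cf df]; split=> //; first by move=> y /VU /cf.
  by move=> y /VU /cf.
by move=> i; have [d1 d2] := df i; split=> [y /VU /d1 //|]; exact: IH.
Qed.

Lemma Ck_local k U f :
  (forall y, U y -> exists2 V, V y & Ck k V f) -> Ck k U f.
Proof.
elim: k f => [|k IH] f loc; split=> //.
- by move=> y /loc[V Vy [/(_ _ Vy)]].
- by move=> y /loc[V Vy [/(_ _ Vy)]].
- move=> i; split; first by move=> y /loc[V Vy [_ /(_ i)[/(_ _ Vy)]]].
  by apply: IH => y /loc[V Vy [_ /(_ i)[_ ?]]]; exists V.
Qed.

Lemma Ck_eq k U f g :
  open U -> (forall y, U y -> f y = g y) -> Ck k U f -> Ck k U g.
Proof.
move=> oU; elim: k f g => [|k IH] f g fg [cf df]; split=> //.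
- by move=> y Uy; exact: open_eq_continuous oU fg Uy (cf _ Uy).
- by move=> y Uy; exact: open_eq_continuous oU fg Uy (cf _ Uy).
- move=> i; have [d1 d2] := df i; split=> [y Uy|].
    exact: near_eq_derivable (near_open_eq oU fg Uy) (d1 _ Uy).
  apply: IH d2 => y Uy; exact: near_eq_derive (near_open_eq oU fg Uy).
Qed.

Lemma CkW k U f : Ck k.+1 U f -> Ck k U f.
Proof.
elim: k f => [|k IH] f [cf df]; split=> // i.
by have [d1 d2] := df i; split=> //; exact: IH.
Qed.

Lemma Ck_cst k U (c : R) : Ck k U (fun=> c).
Proof.
elim: k c => [|k IH] c; split=> //; try by move=> y _; exact: cst_continuous.
move=> i; split=> [y _|]; first exact: derivable_cst.
suff -> : (fun y : 'rV[R]_n => 'D_(delta_mx 0 i) (fun=> c) y) = (fun=> 0) by exact: IH.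
by apply/funext => y; exact: derive_cst.
Qed.

Lemma Ck_add k U f g :
  open U -> Ck k U f -> Ck k U g -> Ck k U (fun y => f y + g y).
Proof.
move=> oU; elim: k f g => [|k IH] f g [cf df] [cg dg]; split=> //;
  try by move=> y Uy; apply: continuousD; [exact: cf|exact: cg].
move=> i; have [d1 d2] := df i; have [e1 e2] := dg i.
split=> [y Uy|]; first exact: derivableD (d1 _ Uy) (e1 _ Uy).
apply: Ck_eq oU _ (IH _ _ d2 e2) => y Uy; apply/esym.
exact: deriveD (d1 _ Uy) (e1 _ Uy).
Qed.

Lemma Ck_mul k U f g :
  open U -> Ck k U f -> Ck k U g -> Ck k U (fun y => f y * g y).
Proof.
move=> oU; elim: k f g => [|k IH] f g; first move=> [cf _] [cg _].
  by split=> // y Uy; apply: continuousM; [exact: cf|exact: cg].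
move=> kf kg; have [[cf df] [cg dg]] := (kf, kg); split.
  by move=> y Uy; apply: continuousM; [exact: cf|exact: cg].
move=> i; have [d1 d2] := df i; have [e1 e2] := dg i.
split=> [y Uy|]; first exact: derivableM (d1 _ Uy) (e1 _ Uy).
apply: Ck_eq oU _ (Ck_add oU (IH _ _ (CkW kf) e2) (IH _ _ (CkW kg) d2)) => y Uy.
by apply/esym; exact: deriveM (d1 _ Uy) (e1 _ Uy).
Qed.

(** The chain rule for a directional derivative, reduced to the one-variable
    chain rule along the line through [y] in the direction [v]. *)
Lemma is_derive_comp1 (h : R -> R) (dh : R) u y v :
  is_derive (u y) 1 h dh -> derivable u y v ->
  is_derive y v (fun z => h (u z)) (dh * 'D_v u y).
Proof.
move=> hd ud; pose w := fun t : R => u (t *: v + y).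
have w0 : w 0 = u y by rewrite /w scale0r add0r.
have Dline (f : 'rV[R]_n -> R) : 'D_v f y = 'D_1 (fun t : R => f (t *: v + y)) 0.
  rewrite /derive; set g1 := (X in lim (X @ _) = _).
  set g2 := (X in _ = lim (X @ _)); suff -> : g1 = g2 by [].
  by apply/funext => t; rewrite /g1 /g2 /= addr0 scale0r add0r [t *: 1]mulr1.
have wd : is_derive (0 : R) (1 : R) w ('D_v u y).
  by rewrite Dline; apply: derivableP; exact: (derivable1P u y v).1 ud.
have hwd : is_derive (0 : R) (1 : R) (h \o w) (dh * 'D_v u y).
  by apply: is_derive1_comp; rewrite w0.
apply: DeriveDef; first by apply: (derivable1P _ _ _).2; case: hwd.
by rewrite Dline; case: hwd.
Qed.

(** The outer function comes with all its derivatives [h k]; giving them as a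
    family avoids iterated derivatives, and serves for the reciprocal as well as
    for [exp (-1/t)]. *)
Lemma Ck_comp (h : nat -> R -> R) (W : set R) k U u :
  (forall k t, W t -> is_derive t 1 (h k) (h k.+1 t)) ->
  open U -> (forall y, U y -> W (u y)) -> Ck k U u ->
  forall j, Ck k U (fun y => h j (u y)).
Proof.
move=> hd oU UW; have cont j y : U y -> {for y, continuous u} ->
    {for y, continuous (fun y => h j (u y))}.
  move=> Uy cu; apply: continuous_comp => //.
  apply: differentiable_continuous; apply/derivable1_diffP.
  by have [] := hd j _ (UW _ Uy).
elim: k u UW cont => [|k IH] u UW cont ku j.
  by split=> // y Uy; apply: cont => //; case: ku => /(_ _ Uy).
have [cu du] := ku; split=> [y Uy|i]; first exact: cont (cu _ Uy).
have [d1 d2] := du i.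
have D y : U y -> is_derive y (delta_mx 0 i) (fun z => h j (u z))
    (h j.+1 (u y) * 'D_(delta_mx 0 i) u y).
  by move=> Uy; apply: is_derive_comp1 (d1 _ Uy); exact: hd (UW _ Uy).
split=> [y /D[] //|].
apply: Ck_eq oU _ (Ck_mul oU (IH _ UW cont (CkW ku) j.+1) d2) => y Uy.
by have [_ ->] := D y Uy.
Qed.

Lemma Ck_inv k U f :
  open U -> (forall y, U y -> f y != 0) -> Ck k U f ->
  Ck k U (fun y => (f y)^-1).
Proof.
pose h j (t : R) := (-1) ^+ j * j`!%:R * t ^- j.+1.
move=> oU f0 kf; have := @Ck_comp h [set t | t != 0] k U f _ oU f0 kf 0.
rewrite /h /= => H; apply: Ck_eq oU _ (H _) => [y Uy|j t /= t0].
  by rewrite expr0 fact0 !mul1r expr1.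
have e : is_derive t 1 (fun t : R => t ^+ j.+1) (j.+1%:R * t ^+ j).
  by apply: DeriveDef; [exact: exprn_derivable|rewrite exp_derive [LHS]mulr1].
have tn0 : t ^+ j.+1 != 0 by rewrite expf_neq0.
have e' := @is_deriveV _ (fun t => t ^+ j.+1) t _ 1 tn0 e.
have := is_deriveZ ((-1) ^+ j * j`!%:R) e'.
move=> E; apply: (is_derive_eq E).
rewrite factS natrM !exprS /GRing.scale /=.
have : t ^+ j != 0 by rewrite expf_neq0.
move: (t ^+ j) => a a0.
by field; rewrite t0 a0.
Qed.

End Ck.

(** * A flat function *)

(** These functions are smooth, flat at [0], and closed under derivation, which is why
    all the polynomials [p] are considered at once. *)
Definition flat (R : realType) (p : {poly R}) (t : R) : R :=
  if 0 < t then p.[t^-1] * expR (- t^-1) else 0.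

(** Coefficientwise, [u^i <= i! exp u]. *)
Lemma poly_le_expR (R : realType) (p : {poly R}) :
  exists2 C, 0 <= C & forall u, 0 <= u -> `|p.[u]| <= C * expR u.
Proof.
exists (\sum_(i < size p) `|p`_i| * i`!%:R) => [|u u0].
  by apply: sumr_ge0 => i _; rewrite mulr_ge0.
rewrite horner_coef mulr_suml; apply: le_trans (ler_norm_sum _ _ _) _.
apply: ler_sum => i _; rewrite normrM -mulrA; apply: ler_wpM2l => //.
rewrite normrX (ger0_norm u0) mulrC -ler_pdivrMr ?ltr0n ?fact_gt0 //.
case: i => -[|i] /= _; last first.
  by apply: le_trans (expR_ge1Dxn i u0); rewrite lerDr.
by rewrite expr0 divr1; apply: le_trans (expR_ge1Dx u); rewrite lerDl.
Qed.

Lemma quadratic_is_derive0 (R : realType) (f : R -> R) (C : R) :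
  (forall t, `|f t| <= C * t ^+ 2) -> is_derive (0 : R) (1 : R) f 0.
Proof.
move=> fC.
have f0 : f 0 = 0.
  by apply/eqP; rewrite -normr_le0; apply: le_trans (fC 0) _; rewrite expr0n mulr0.
have cv : (fun h : R => h^-1 *: ((f \o shift 0) (h *: (1 : R)) - f 0)) @ 0^' --> (0 : R).
  have cC : (fun h : R => C * `|h|) @ 0^' --> (0 : R).
    have : (fun h : R => C * `|h|) @ (0:R) --> C * `|0 : R|.
      apply: cvgM; first exact: cvg_cst.
      by apply: cvg_norm; exact: cvg_id.
    by rewrite normr0 mulr0; apply: cvg_trans; apply: cvg_app; exact: nbhs_dnbhs.
  apply/cvgr0Pnorm_le => e e0.
  move/cvgr0Pnorm_le : cC => /(_ e e0); apply: filterS => h.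
  apply: le_trans; rewrite /= f0 subr0 addr0 [h *: 1]mulr1 /GRing.scale /= normrM.
  have [->|h0] := eqVneq h 0; first by rewrite f0 normr0 mulr0.
  rewrite normfV mulrC ler_pdivrMr ?normr_gt0 //.
  apply: le_trans (fC h) _; apply: le_trans (ler_norm _) _.
  by rewrite normrM normrX [in leRHS]normrM normr_id expr2 mulrA.
by apply: DeriveDef; [apply/cvg_ex; exists 0|exact: cvg_lim cv].
Qed.

(** With [u = 1/t], this is the bound of [p(u) u^2] by a multiple of [exp u]. *)
Lemma flat_quadratic (R : realType) (p : {poly R}) :
  exists C, forall t, `|flat p t| <= C * t ^+ 2.
Proof.
have [C C0 pC] := poly_le_expR (p * 'X^2); exists C => t.
rewrite /flat; case: ifPn => [t0|_]; last by rewrite normr0 mulr_ge0 ?sqr_ge0.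
have u0 : 0 < t^-1 by rewrite invr_gt0.
have := pC _ (ltW u0); rewrite hornerM hornerXn normrM normrX (gtr0_norm u0) => H.
rewrite normrM (gtr0_norm (expR_gt0 _)) expRN ler_pdivrMr ?expR_gt0 //.
by rewrite mulrAC -ler_pdivrMr ?exprn_gt0 // -exprVn.
Qed.

Lemma is_derive_flat (R : realType) (p : {poly R}) (t : R) :
  is_derive t 1 (flat p) (flat ((p - p^`()) * 'X^2) t).
Proof.
have [t0|t0|->] := ltgtP t 0; last 1 first.
- have [C pC] := flat_quadratic p.
  by rewrite /flat ltxx; exact: quadratic_is_derive0 pC.
- rewrite /flat ltNge ltW //=.
  apply: (@near_eq_is_derive _ _ _ (fun=> 0)).
  near=> s; rewrite ifF //; apply/negbTE; rewrite -leNgt ltW //.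
  by near: s; exact: lt_nbhsl.
- have tn0 : t != 0 by rewrite gt_eqF.
  have dV : is_derive t 1 (fun s : R => s^-1) (- t ^- 2 *: 1).
    exact: (@is_deriveV _ id t 1 1).
  have dN : is_derive t 1 (fun s : R => - s^-1) (- (- t ^- 2 *: 1)) by exact: is_deriveN.
  have dE := @is_derive1_comp _ expR (fun s : R => - s^-1) t _ _ (is_derive_expR _) dN.
  have dP := @is_derive1_comp _ (horner p) (fun s : R => s^-1) t _ _ (is_derive_poly p _) dV.
  have E : \near t, p.[t^-1] * expR (- t^-1) = flat p t.
    by near=> s; rewrite /flat ifT //; near: s; exact: lt_nbhsr.
  apply: (is_derive_eq (near_eq_is_derive E (is_deriveM dP dE))) => /=.
  rewrite /flat t0 !hornerE /GRing.scale /= ?exprVn.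
  move: (expR _) => e; move: p.[_] (p^`()).[_] => a b.
  by field.
Unshelve. all: by end_near. Qed.

Lemma flat_gt0 (R : realType) (t : R) : 0 < t -> 0 < flat 1 t.
Proof. by move=> t0; rewrite /flat t0 hornerC mul1r expR_gt0. Qed.

Lemma flat_le0 (R : realType) (p : {poly R}) (t : R) : t <= 0 -> flat p t = 0.
Proof. by move=> t0; rewrite /flat ltNge t0. Qed.

Lemma Ck_flat (R : realType) n k (U : set 'rV[R]_n) (u : 'rV[R]_n -> R) :
  open U -> Ck k U u -> Ck k U (fun y => flat 1 (u y)).
Proof.
move=> oU ku.
pose h j := flat (iter j (fun p : {poly R} => (p - p^`()) * 'X^2) 1).
apply: (@Ck_comp R n h setT k U u _ oU _ ku 0) => // j t _.
exact: is_derive_flat.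
Qed.

(** * Smooth functions on manifolds *)

Section SmoothOn.
Context (R : realType) (M : manifold R).
Implicit Types (U V : set M) (f g : M -> R).

(** Near the image of a point, it is cut out of the image of the chart by a condition on
    [cinv c], which is continuous there. *)
Lemma chart_image_open c U :
  @atlas R M c -> open U -> open (cmap c @` (cdom c `&` U)).
Proof.
move=> /atlas_chart[od ow K _ ci] oU; rewrite openE => y [x [cx Ux] <-].
have Wx : (cmap c @` cdom c) (cmap c x) by exists x.
have n1 : nbhs (cmap c x) (cmap c @` cdom c) by exact: open_nbhs_nbhs.
have n2 : nbhs (cmap c x) (cinv c @^-1` U).
  by apply: (ci _ Wx); rewrite K //; exact: open_nbhs_nbhs.
rewrite /interior; apply: filterS2 n1 n2 => z [x' cx' <-].
by rewrite /preimage /= K // => Ux'; exists x'.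
Qed.

Lemma smooth_on_subset U V f : V `<=` U -> smooth_on U f -> smooth_on V f.
Proof.
move=> VU sf c Ac k; apply: Ck_subset (sf c Ac k).
by move=> _ [x [cx Vx] <-]; exists x => //; split=> //; exact: VU.
Qed.

Lemma smooth_on_eq U f g :
  open U -> (forall x, U x -> f x = g x) -> smooth_on U f -> smooth_on U g.
Proof.
move=> oU fg sf c Ac k; apply: Ck_eq (chart_image_open Ac oU) _ (sf c Ac k).
move=> _ [x [cx Ux] <-]; have [_ _ K _ _] := atlas_chart Ac.
by rewrite K // fg.
Qed.

Lemma smooth_on_local U f :
  (forall x, U x -> exists2 V, V x & smooth_on V f) -> smooth_on U f.
Proof.
move=> loc c Ac k; apply: Ck_local => _ [x [cx Ux] <-].
have [V Vx sV] := loc _ Ux; exists (cmap c @` (cdom c `&` V)); last exact: sV.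
by exists x.
Qed.

Lemma smooth_on_cst U (a : R) : @smooth_on R M U (fun=> a).
Proof. by move=> c Ac k; exact: Ck_cst. Qed.

Lemma smooth_on_add U f g : open U ->
  smooth_on U f -> smooth_on U g -> smooth_on U (fun x => f x + g x).
Proof.
move=> oU sf sg c Ac k.
exact: Ck_add (chart_image_open Ac oU) (sf c Ac k) (sg c Ac k).
Qed.

Lemma smooth_on_mul U f g : open U ->
  smooth_on U f -> smooth_on U g -> smooth_on U (fun x => f x * g x).
Proof.
move=> oU sf sg c Ac k.
exact: Ck_mul (chart_image_open Ac oU) (sf c Ac k) (sg c Ac k).
Qed.

Lemma smooth_on_opp U f : open U -> smooth_on U f -> smooth_on U (fun x => - f x).
Proof.
move=> oU sf; apply: (smooth_on_eq oU (f := fun x => -1 * f x)).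
  by move=> x _; rewrite mulN1r.
by apply: smooth_on_mul => //; exact: smooth_on_cst.
Qed.

Lemma smooth_on_sum (I : Type) (r : seq I) U (F : I -> M -> R) : open U ->
  (forall i, smooth_on U (F i)) -> smooth_on U (fun x => \sum_(i <- r) F i x).
Proof.
move=> oU sF; elim: r => [|i r IH].
  by apply: smooth_on_eq oU _ (@smooth_on_cst U 0) => x _; rewrite big_nil.
apply: smooth_on_eq oU _ (smooth_on_add oU (sF i) IH) => x _.
by rewrite big_cons.
Qed.

Lemma smooth_on_prod (I : Type) (r : seq I) U (F : I -> M -> R) : open U ->
  (forall i, smooth_on U (F i)) -> smooth_on U (fun x => \prod_(i <- r) F i x).
Proof.
move=> oU sF; elim: r => [|i r IH].
  by apply: smooth_on_eq oU _ (@smooth_on_cst U 1) => x _; rewrite big_nil.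
apply: smooth_on_eq oU _ (smooth_on_mul oU (sF i) IH) => x _.
by rewrite big_cons.
Qed.

Lemma smooth_on_inv U f : open U -> (forall x, U x -> f x != 0) ->
  smooth_on U f -> smooth_on U (fun x => (f x)^-1).
Proof.
move=> oU f0 sf c Ac k.
apply: Ck_inv (chart_image_open Ac oU) _ (sf c Ac k) => _ [x [cx Ux] <-].
by have [_ _ K _ _] := atlas_chart Ac; rewrite K // f0.
Qed.

Lemma smooth_on_continuous U f x :
  open U -> U x -> smooth_on U f -> {for x, continuous f}.
Proof.
move=> oU Ux sf; have [c Ac cx] := atlas_cover x.
have [od _ K cc ci] := atlas_chart Ac.
have oV : open (cdom c `&` U) by exact: openI.
apply: (@open_eq_continuous _ _ _ (fun z => f (cinv c (cmap c z))) f x oV) => //.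
  by move=> z [cz _]; rewrite K.
apply: (@continuous_comp _ _ _ (cmap c) (fun y => f (cinv c y))).
  exact: cc.
have [cf _] := sf c Ac 0%N; apply: (cf (cmap c x)); by exists x.
Qed.

End SmoothOn.

(** A box around the image of [x] in a chart is compact, so its image [K] is closed
    by the Hausdorff property, and extending by zero off [K] is smooth.
    The factors are flat functions of the coordinates of one chart, so the bump
    function is smooth in every other chart by the one-variable chain rule
    alone. *)
Lemma bump_function (R : realType) (M : manifold R) (U : set M) (x : M) :
  open U -> U x -> exists phi : M -> R, exists K : set M,
    [/\ smooth phi, phi x = 1, closed K, K `<=` U & forall y, ~ K y -> phi y = 0].
Proof.
move=> oU Ux; have [c Ac cx] := atlas_cover x.
have [od ow cK cc ci] := atlas_chart Ac.
have oW := chart_image_open Ac oU.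
set W := _ @` _ in oW; pose y0 := cmap c x.
have Wy0 : W y0 by exists x.
have /nbhs_ballP[e /= e0 eW] : nbhs y0 W by exact: open_nbhs_nbhs.
(* Balls are strict, so half the radius makes the closed box [B] fit. *)
pose r := e / 2; have r0 : 0 < r by rewrite divr_gt0.
pose B := [set y : 'rV[R]_(mdim M) |
  forall i, `[y0 0 i - r, y0 0 i + r]%classic (y ord0 i)].
have BW : B `<=` W.
  move=> y By; apply: eW; split=> // i j; rewrite (ord1 i).
  have := By j; rewrite /= in_itv /= => /andP[h1 h2].
  rewrite /ball /= ltr_norml; rewrite /r in h1 h2; apply/andP; split; lra.
have cB : compact B.
  exact: (@rV_compact R (mdim M) (fun i => `[y0 0 i - r, y0 0 i + r]%classic) (fun i => @segment_compact R _ _)).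
pose K := cinv c @` B.
have KcU : K `<=` cdom c `&` U by move=> _ [y /BW[z [cz Uz] <-] <-]; rewrite cK.
have clK : closed K.
  apply: compact_closed; first exact: manifold_hausdorff.
  apply: continuous_compact => //; apply: continuous_in_subspaceT => y.
  rewrite inE => /BW[z [cz Uz] <-]; apply: ci; by exists z.
pose F j z := flat 1 (r ^+ 2 - (cmap c z 0 j - y0 0 j) ^+ 2).
pose D := \prod_j F j x.
have D0 : D != 0.
  apply/prodf_neq0 => j _; rewrite gt_eqF // flat_gt0 // /y0 subrr expr0n subr0.
  by rewrite exprn_gt0.
pose phi z := if z \in cdom c then D^-1 * \prod_j F j z else 0.
have phiK z : ~ K z -> phi z = 0.
  move=> Kz; rewrite /phi; case: ifPn => //; rewrite inE => cz.
  have : ~ B (cmap c z) by move=> Bz; apply: Kz; exists (cmap c z) => //; rewrite cK.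
  move=> /existsNP[j]; rewrite /= in_itv /= => nj.
  rewrite (bigD1 j) //= {1}/F flat_le0 ?mul0r ?mulr0 //.
  rewrite subr_le0 leNgt; apply/negP => lt; apply: nj.
  have : `|cmap c z 0 j - y0 0 j| < r.
    by rewrite -(ltr_pXn2r (n := 2)) ?nnegrE ?(ltW r0) // real_normK ?num_real.
  rewrite ltr_norml => /andP[h1 h2]; apply/andP; split; lra.
exists phi, K; split=> //; last 2 first.
- by rewrite /phi mem_set // mulVf.
- by move=> z /KcU[].
apply: smooth_on_local => z _; have [Kz|Kz] := pselect (K z); last first.
  exists (~` K) => //; apply: smooth_on_eq (smooth_on_cst _ 0).
    by rewrite openC.
  by move=> y /phiK.
exists (cdom c); first by case: (KcU _ Kz).
apply: (@smooth_on_eq _ _ _ (fun z => D^-1 * \prod_j F j z)) => //.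
  by move=> y cy; rewrite /phi mem_set.
apply: smooth_on_mul => //; first exact: smooth_on_cst.
apply: smooth_on_prod => // j c' Ac' k.
have oI := chart_image_open Ac' od.
apply: Ck_flat => //.
have Cu := atlas_compat Ac' Ac j k.
have Cd : Ck k (cmap c' @` (cdom c' `&` cdom c))
    (fun y => cmap c (cinv c' y) 0 j + - y0 0 j).
  by apply: Ck_add => //; exact: Ck_cst.
apply: (Ck_eq oI (f := fun y => r ^+ 2 + -1 * ((cmap c (cinv c' y) 0 j + - y0 0 j)
    * (cmap c (cinv c' y) 0 j + - y0 0 j)))).
  by move=> y _; rewrite mulN1r expr2.
by repeat (apply: Ck_add || apply: Ck_mul || exact: Ck_cst || exact: Cu) => //.
Qed.

(** * Smooth sections *)

Lemma smooth_cst (R : realType) (M : manifold R) (a : R) : @smooth R M (fun=> a).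
Proof. exact: smooth_on_cst. Qed.

Lemma smooth_add (R : realType) (M : manifold R) (f g : M -> R) :
  smooth f -> smooth g -> smooth (fun x => f x + g x).
Proof. exact: smooth_on_add openT. Qed.

Lemma smooth_mul (R : realType) (M : manifold R) (f g : M -> R) :
  smooth f -> smooth g -> smooth (fun x => f x * g x).
Proof. exact: smooth_on_mul openT. Qed.

Lemma smooth_opp (R : realType) (M : manifold R) (f : M -> R) :
  smooth f -> smooth (fun x => - f x).
Proof. exact: smooth_on_opp openT. Qed.

Lemma smooth_restrict (R : realType) (M : manifold R) (U : set M) (f : M -> R) :
  smooth f -> smooth_on U f.
Proof. exact: smooth_on_subset. Qed.

Lemma open_neq0 (R : realType) (M : manifold R) (f : M -> R) :
  smooth f -> open [set x | f x != 0].
Proof.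
move=> sf; apply: (@open_comp _ _ f [set r | r != 0]); last exact: open_neq.
by move=> x _; exact: smooth_on_continuous openT I sf.
Qed.

Section Bundle.
Context (R : realType) (M : manifold R) (E : vector_bundle M).
Implicit Types (s t : sect E) (f : M -> R).

Lemma frame_expand (T : triv (rank E) E) x (v : E x) : trivs T -> tdom T x ->
  v = \sum_i tmap T x v 0 i *: frame T i x.
Proof.
move=> AT Tx; rewrite -{1}(tmapK AT Tx v) {1}(row_sum_delta (tmap T x v)) linear_sum.
by apply: eq_bigr => i _; rewrite linearZ.
Qed.

Lemma tmap_frame (T : triv (rank E) E) x i j : trivs T -> tdom T x ->
  tmap T x (frame T i x) 0 j = (j == i)%:R.
Proof. by move=> AT Tx; rewrite /frame tinvK // mxE eqxx. Qed.

Lemma dual_frameE (T : triv (rank E) E) x i (v : E x) :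
  (frame (dual_triv T) i x : 'Hom(E x, R^o)) v = tmap T x v 0 i.
Proof.
rewrite /frame dual_tinvE (bigD1 i) //= mxE !eqxx mul1r big1 ?addr0 // => j ji.
by rewrite mxE eqxx (negbTE ji) mul0r.
Qed.

Lemma smooth_sect_add s t :
  smooth_sect s -> smooth_sect t -> smooth_sect (fun x => s x + t x).
Proof.
move=> ss st T j AT.
apply: (smooth_on_eq (triv_open AT)) (smooth_on_add (triv_open AT) (ss T j AT) (st T j AT)).
by move=> x _; rewrite linearD mxE.
Qed.

Lemma smooth_sect_scale f s :
  smooth f -> smooth_sect s -> smooth_sect (fun x => f x *: s x).
Proof.
move=> sf ss T j AT; have oT := triv_open AT.
apply: (smooth_on_eq oT) (smooth_on_mul oT (smooth_restrict _ sf) (ss T j AT)).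
by move=> x _; rewrite linearZ mxE.
Qed.

Lemma smooth_sect_cst0 : smooth_sect (fun x => 0 : E x).
Proof.
move=> T j AT; apply: (smooth_on_eq (triv_open AT)) (smooth_on_cst _ 0).
by move=> x _; rewrite linear0 mxE.
Qed.

Lemma smooth_sect_opp s : smooth_sect s -> smooth_sect (fun x => - s x).
Proof.
move=> /(smooth_sect_scale (smooth_cst (-1))); congr smooth_sect.
by apply: functional_extensionality_dep => x; rewrite scaleN1r.
Qed.

(** Off the closed set [K] the section vanishes, and [K] lies in the domain of [T]; two
    open sets thus cover the manifold. *)
Lemma smooth_frame_bump (T : triv (rank E) E) i (K : set M) (phi : M -> R) :
  trivs T -> closed K -> K `<=` tdom T -> smooth phi -> (forall y, ~ K y -> phi y = 0) ->
  smooth_sect (fun x => phi x *: frame T i x).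
Proof.
move=> AT cK KT sphi phiK T' j AT'.
have oT := triv_open AT; have oT' := triv_open AT'.
have oK : open (~` K) by rewrite openC.
apply: smooth_on_local => x T'x; have [Kx|Kx] := pselect (K x).
  exists (tdom T `&` tdom T'); first by split=> //; exact: KT.
  have oI : open (tdom T `&` tdom T') by exact: openI.
  apply: (smooth_on_eq oI) (smooth_on_mul oI (smooth_restrict _ sphi) (triv_compat i j AT AT')).
  by move=> y _; rewrite linearZ mxE.
exists (~` K) => //; apply: (smooth_on_eq oK) (smooth_on_cst _ 0).
by move=> y /phiK ->; rewrite scale0r linear0 mxE.
Qed.

Lemma smooth_dualP (al : sect (dual_bundle E)) : smooth_sect al <->
  forall (T : triv (rank E) E) i, trivs T ->
    smooth_on (tdom T) (fun x => (al x : 'Hom(E x, R^o)) (frame T i x) : R).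
Proof.
split=> [sal T i AT|H _ i [T AT <-] /=].
  have AdT : trivs (dual_triv T : triv (rank (dual_bundle E)) (dual_bundle E)) by exists T.
  apply: (smooth_on_eq (triv_open AT)) (sal _ i AdT) => x _.
  by rewrite dual_tmapE mxE.
apply: (smooth_on_eq (triv_open AT)) (H T i AT) => x _.
by rewrite dual_tmapE mxE.
Qed.

Lemma smooth_contract al s :
  @smooth_sect _ _ (dual_bundle E) al -> smooth_sect s -> smooth (contract al s).
Proof.
move=> /smooth_dualP sal ss; apply: smooth_on_local => x _.
have [T AT Tx] := triv_cover E x; exists (tdom T) => //; have oT := triv_open AT.
apply: (smooth_on_eq oT (f := fun y => \sum_i tmap T y (s y) 0 i *
    (al y : 'Hom(E y, R^o)) (frame T i y))).
  move=> y Ty; rewrite /contract [in RHS](frame_expand (s y) AT Ty) linear_sum.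
  by apply: eq_bigr => i _; rewrite linearZ.
by apply: smooth_on_sum => // i; apply: smooth_on_mul => //; [exact: ss|exact: sal].
Qed.

End Bundle.

Section Frame.
Context (R : realType) (M : manifold R) (E : vector_bundle M).
Implicit Types (s t : sect E) (f : M -> R).

(** A global substitute for a local frame at [x]: the error term [h^2 v] vanishes
    to second order at [x], so no derivation sees it there.  For a bump function
    [phi] at [x] this is [1 = (1 - phi^2)^2 + (2 - phi^2) phi^2]. *)
Lemma global_frame x : exists h : M -> R,
  exists e : 'I_(rank E) -> sect E, exists eps : 'I_(rank E) -> sect (dual_bundle E),
  [/\ smooth h, h x = 0, forall i, smooth_sect (e i), forall i, smooth_sect (eps i) &
    forall y (v : E y), v = (h y * h y) *: v
      + \sum_i (eps i y : 'Hom(E y, R^o)) v *: e i y].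
Proof.
have [T AT Tx] := triv_cover E x.
have [phi [K [sphi phix cK KT phiK]]] := bump_function (triv_open AT) Tx.
have AdT : trivs (dual_triv T : triv (rank (dual_bundle E)) (dual_bundle E)) by exists T.
exists (fun y => 1 - phi y * phi y).
exists (fun i y => (2 - phi y * phi y) *: (phi y *: frame T i y)).
exists (fun i y => phi y *: frame (dual_triv T) i y); split.
- by apply: smooth_add; [exact: smooth_cst|apply: smooth_opp; exact: smooth_mul].
- by rewrite phix mulr1 subrr.
- move=> i; apply: smooth_sect_scale; last exact: smooth_frame_bump KT sphi phiK.
  by apply: smooth_add; [exact: smooth_cst|apply: smooth_opp; exact: smooth_mul].
- move=> i; exact: (@smooth_frame_bump R M (dual_bundle E) (dual_triv T) i K phi).
move=> y v; have [Ky|/phiK ->] := pselect (K y); last first.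
  rewrite mulr0 subr0 mulr1 scale1r big1 ?addr0 // => i _.
  by rewrite !scale0r !scaler0.
rewrite [X in _ = _ *: X + _](frame_expand v AT (KT _ Ky)) {1}(frame_expand v AT (KT _ Ky)).
rewrite scaler_sumr -big_split /=; apply: eq_bigr => i _.
rewrite scale_lfunE dual_frameE /= !scalerA -scalerDl; congr (_ *: _).
rewrite /GRing.scale /=; ring.
Qed.

(** Near [x] the local frame is a combination of the global sections [e j], because
    [1 - h^2] is invertible there. *)
Lemma smooth_dual_test (al : sect (dual_bundle E)) :
  (forall s, smooth_sect s -> smooth (contract al s)) -> smooth_sect al.
Proof.
move=> H; apply/smooth_dualP => T i AT; apply: smooth_on_local => x Tx.
have oT := triv_open AT.
have [h [e [eps [sh hx se seps hE]]]] := global_frame x.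
have s1 : smooth (fun y => 1 - h y * h y).
  by apply: smooth_add; [exact: smooth_cst|apply: smooth_opp; exact: smooth_mul].
pose V := tdom T `&` [set y | 1 - h y * h y != 0].
have oV : open V by apply: openI => //; exact: open_neq0.
exists V; first by split=> //=; rewrite hx mulr0 subr0 oner_neq0.
apply: (smooth_on_eq oV (f := fun y => (1 - h y * h y)^-1 *
    \sum_j (eps j y : 'Hom(E y, R^o)) (frame T i y) * contract al (e j) y)).
  move=> y [Ty /= ny]; apply: (mulfI ny); rewrite mulVKf //.
  rewrite mulrBl mul1r {2}(hE y (frame T i y)) linearD linear_sum linearZ.
  rewrite addrC addKr; apply: eq_bigr => j _.
  by rewrite linearZ.
apply: smooth_on_mul => //.
  by apply: smooth_on_inv => //; [move=> y [] | exact: smooth_restrict].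
apply: smooth_on_sum => // j; apply: smooth_on_mul => //.
  have /smooth_dualP/(_ T i AT) := seps j.
  by apply: smooth_on_subset => y [].
by apply: smooth_restrict; exact: H.
Qed.

End Frame.

(** * The ring of smooth functions and its modules of sections *)

Definition smooth_fun (R : realType) (M : manifold R) : Type := {f : M -> R | smooth f}.

Definition fval (R : realType) (M : manifold R) (f : smooth_fun M) : M -> R := sval f.

Definition sections (R : realType) (M : manifold R) (E : vector_bundle M) : Type :=
  {s : sect E | smooth_sect s}.

Definition sectv (R : realType) (M : manifold R) (E : vector_bundle M)
  (s : sections E) : sect E := sval s.

Section SmoothFun.
Context (R : realType) (M : manifold R).
Implicit Types f g h : smooth_fun M.

Lemma fval_smooth f : smooth (fval f). Proof. exact: proj2_sig f. Qed.

Lemma fval_inj f g : (forall x, fval f x = fval g x) -> f = g.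
Proof.
case: f g => [f sf] [g sg] /= fg; have {}fg : f = g by apply/funext.
by rewrite -fg in sg *; rewrite (Prop_irrelevance sf sg).
Qed.

Definition sfadd f g : smooth_fun M := exist _ _ (smooth_add (fval_smooth f) (fval_smooth g)).
Definition sfmul f g : smooth_fun M := exist _ _ (smooth_mul (fval_smooth f) (fval_smooth g)).
Definition sfopp f : smooth_fun M := exist _ _ (smooth_opp (fval_smooth f)).
Definition sfcst (a : R) : smooth_fun M := exist _ _ (smooth_cst a).

HB.instance Definition _ := gen_eqMixin (smooth_fun M).
HB.instance Definition _ := gen_choiceMixin (smooth_fun M).

Fact sfaddA : associative sfadd.
Proof. by move=> f g h; apply: fval_inj => x; exact: addrA. Qed.
Fact sfaddC : commutative sfadd.
Proof. by move=> f g; apply: fval_inj => x; exact: addrC. Qed.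
Fact sfadd0 : left_id (sfcst 0) sfadd.
Proof. by move=> f; apply: fval_inj => x; exact: add0r. Qed.
Fact sfaddN : left_inverse (sfcst 0) sfopp sfadd.
Proof. by move=> f; apply: fval_inj => x; exact: addNr. Qed.
HB.instance Definition _ :=
  GRing.isZmodule.Build (smooth_fun M) sfaddA sfaddC sfadd0 sfaddN.

Fact sfmulA : associative sfmul.
Proof. by move=> f g h; apply: fval_inj => x; exact: mulrA. Qed.
Fact sfmulC : commutative sfmul.
Proof. by move=> f g; apply: fval_inj => x; exact: mulrC. Qed.
Fact sfmul1 : left_id (sfcst 1) sfmul.
Proof. by move=> f; apply: fval_inj => x; exact: mul1r. Qed.
Fact sfmulD : left_distributive sfmul sfadd.
Proof. by move=> f g h; apply: fval_inj => x; exact: mulrDl. Qed.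
HB.instance Definition _ :=
  GRing.Zmodule_isComPzRing.Build (smooth_fun M) sfmulA sfmulC sfmul1 sfmulD.

Lemma fvalD f g x : fval (f + g) x = fval f x + fval g x. Proof. by []. Qed.
Lemma fvalM f g x : fval (f * g) x = fval f x * fval g x. Proof. by []. Qed.
Lemma fvalN f x : fval (- f) x = - fval f x. Proof. by []. Qed.
Lemma fval0 x : fval (0 : smooth_fun M) x = 0. Proof. by []. Qed.
Lemma fval1 x : fval (1 : smooth_fun M) x = 1. Proof. by []. Qed.
Definition fvalE := (fvalD, fvalM, fvalN, fval0, fval1).

Lemma fval_sum (I : Type) (r : seq I) (F : I -> smooth_fun M) x :
  fval (\sum_(i <- r) F i) x = \sum_(i <- r) fval (F i) x.
Proof. by elim: r => [|i r IH]; rewrite ?big_nil // !big_cons fvalD IH. Qed.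

Section Sections.
Context (E : vector_bundle M).
Implicit Types s t u : sections E.

Lemma sectv_smooth s : smooth_sect (sectv s). Proof. exact: proj2_sig s. Qed.

Lemma sectv_inj s t : (forall x, sectv s x = sectv t x) -> s = t.
Proof.
case: s t => [s ss] [t st] /= e.
have {}e : s = t by apply: functional_extensionality_dep.
by rewrite -e in st *; rewrite (Prop_irrelevance ss st).
Qed.

Definition scadd s t : sections E :=
  exist _ _ (smooth_sect_add (sectv_smooth s) (sectv_smooth t)).
Definition scopp s : sections E := exist _ _ (smooth_sect_opp (sectv_smooth s)).
Definition sccst0 : sections E := exist _ _ (smooth_sect_cst0 (E := E)).
Definition scscale f s : sections E :=
  exist _ _ (smooth_sect_scale (fval_smooth f) (sectv_smooth s)).

HB.instance Definition _ := gen_eqMixin (sections E).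
HB.instance Definition _ := gen_choiceMixin (sections E).

Fact scaddA : associative scadd.
Proof. by move=> f g h; apply: sectv_inj => x; exact: addrA. Qed.
Fact scaddC : commutative scadd.
Proof. by move=> f g; apply: sectv_inj => x; exact: addrC. Qed.
Fact scadd0 : left_id sccst0 scadd.
Proof. by move=> f; apply: sectv_inj => x; exact: add0r. Qed.
Fact scaddN : left_inverse sccst0 scopp scadd.
Proof. by move=> f; apply: sectv_inj => x; exact: addNr. Qed.
HB.instance Definition _ :=
  GRing.isZmodule.Build (sections E) scaddA scaddC scadd0 scaddN.

Fact scscaleA f g s : scscale f (scscale g s) = scscale (f * g) s.
Proof. by apply: sectv_inj => x; exact: scalerA. Qed.
Fact scscale1 : left_id 1 scscale.
Proof. by move=> s; apply: sectv_inj => x; exact: scale1r. Qed.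
Fact scscaleDr : right_distributive scscale +%R.
Proof. by move=> f s t; apply: sectv_inj => x; exact: scalerDr. Qed.
Fact scscaleDl s : {morph scscale^~ s : f g / f + g}.
Proof. by move=> f g; apply: sectv_inj => x; exact: scalerDl. Qed.
HB.instance Definition _ := GRing.Zmodule_isLmodule.Build (smooth_fun M) (sections E)
  scscaleA scscale1 scscaleDr scscaleDl.

Lemma sectvD s t x : sectv (s + t) x = sectv s x + sectv t x. Proof. by []. Qed.
Lemma sectvN s x : sectv (- s) x = - sectv s x. Proof. by []. Qed.
Lemma sectvZ f s x : sectv (f *: s) x = fval f x *: sectv s x. Proof. by []. Qed.

Lemma sectv_sum (I : Type) (r : seq I) (F : I -> sections E) x :
  sectv (\sum_(i <- r) F i) x = \sum_(i <- r) sectv (F i) x.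
Proof. by elim: r => [|i r IH]; rewrite ?big_nil // !big_cons sectvD IH. Qed.

End Sections.

Section Pairing.
Context (E : vector_bundle M).

Definition pair (al : sections (dual_bundle E)) (s : sections E) : smooth_fun M :=
  exist _ _ (smooth_contract (sectv_smooth al) (sectv_smooth s)).

Lemma pairE al s x : fval (pair al s) x = (sectv al x : 'Hom(E x, R^o)) (sectv s x).
Proof. by []. Qed.

Lemma pairDl al be s : pair (al + be) s = pair al s + pair be s.
Proof. by apply: fval_inj => x; rewrite !(pairE, fvalE) sectvD add_lfunE. Qed.

Lemma pairZl f al s : pair (f *: al) s = f * pair al s.
Proof. by apply: fval_inj => x; rewrite !(pairE, fvalE) sectvZ scale_lfunE. Qed.

Lemma pairDr al s t : pair al (s + t) = pair al s + pair al t.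
Proof. by apply: fval_inj => x; rewrite !(pairE, fvalE) sectvD linearD. Qed.

Lemma pairZr al f s : pair al (f *: s) = f * pair al s.
Proof. by apply: fval_inj => x; rewrite !(pairE, fvalE) sectvZ linearZ. Qed.

(** [global_frame] for sections, as an identity over the ring of smooth functions. *)
Lemma pair_frame x : exists h : smooth_fun M, exists e : 'I_(rank E) -> sections E,
  exists eps : 'I_(rank E) -> sections (dual_bundle E),
  fval h x = 0 /\ forall s, s = (h * h) *: s + \sum_i pair (eps i) s *: e i.
Proof.
have [h [e [eps [sh hx se seps hE]]]] := global_frame E x.
exists (exist _ h sh), (fun i => exist _ (e i) (se i)).
exists (fun i => exist _ (eps i) (seps i)); split=> // s; apply: sectv_inj => y.
by rewrite sectvD sectvZ sectv_sum {1}(hE y (sectv s y)).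
Qed.

(** The coefficients of a global frame are frozen at [x]. *)
Lemma section_through x (v : E x) : exists s : sections E, sectv s x = v.
Proof.
have [h [e [eps [sh hx se seps hE]]]] := global_frame E x.
exists (\sum_i sfcst ((eps i x : 'Hom(E x, R^o)) v) *: (exist _ (e i) (se i) : sections E)).
by rewrite sectv_sum [RHS](hE x v) hx mulr0 scale0r add0r.
Qed.

Lemma pair_injl al be : (forall s, pair al s = pair be s) -> al = be.
Proof.
move=> H; apply: sectv_inj => x; apply/lfunP => v; have [s <-] := section_through v.
by rewrite -!pairE H.
Qed.

Lemma pair_injr s t : (forall al, pair al s = pair al t) -> s = t.
Proof.
move=> H; apply: sectv_inj => x; have [h [e [eps [hx hE]]]] := pair_frame x.
rewrite (hE s) (hE t) !sectvD !sectvZ fvalM hx mul0r !scale0r !sectv_sum.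
by congr (_ + _); apply: eq_bigr => i _; rewrite !sectvZ H.
Qed.

(** Expand the argument in a global frame at [x]: by linearity the error term
    contributes a multiple of [h^2], and only the values of the coefficients at [x]
    remain. *)
Lemma tensorial (D : sections E -> smooth_fun M) :
  (forall f s t, D (f *: s + t) = f * D s + D t) ->
  forall s t x, sectv s x = sectv t x -> fval (D s) x = fval (D t) x.
Proof.
move=> DL s t x st.
have D0 : D 0 = 0 by have := DL (-1) 0 0; rewrite scaler0 addr0 mulN1r addNr.
have Dsum (I : Type) (r : seq I) (a : I -> smooth_fun M) (e : I -> sections E) :
    D (\sum_(i <- r) a i *: e i) = \sum_(i <- r) a i * D (e i).
  by elim: r => [|i r IH]; rewrite ?big_nil // !big_cons DL IH.
have [h [e [eps [hx hE]]]] := pair_frame x.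
have D1 u : fval (D u) x = \sum_i (sectv (eps i) x : 'Hom(E x, R^o)) (sectv u x) * fval (D (e i)) x.
  by rewrite {1}(hE u) DL Dsum fvalD !fvalM hx !mul0r add0r fval_sum.
by rewrite !D1 st.
Qed.

End Pairing.
End SmoothFun.

(** * The Cartan calculus of a Lie algebroid *)

Section Anchor.
Context (R : realType) (M : manifold R) (A : vector_bundle M) (rho : anchor_map A).
Context (an : is_anchor rho).
Arguments rho : clear implicits.

Lemma anchorD x (u v : A x) f : smooth f -> rho x (u + v) f = rho x u f + rho x v f.
Proof. by move=> sf; rewrite -[u]scale1r (anchor_linear an) // mul1r scale1r. Qed.

Lemma anchor0 x f : smooth f -> rho x (0 : A x) f = 0.
Proof. by move=> sf; apply: (addrI (rho x (0 : A x) f)); rewrite -anchorD // !addr0. Qed.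

Lemma anchorZ x (r : R) (u : A x) f : smooth f -> rho x (r *: u) f = r * rho x u f.
Proof. by move=> sf; rewrite -[r *: u]addr0 (anchor_linear an) // anchor0 // addr0. Qed.

Lemma anchor_sum (I : Type) (r : seq I) x (u : I -> A x) f : smooth f ->
  rho x (\sum_(i <- r) u i) f = \sum_(i <- r) rho x (u i) f.
Proof.
move=> sf; elim: r => [|i r IH]; first by rewrite !big_nil anchor0.
by rewrite !big_cons anchorD // IH.
Qed.

(** A derivation kills [1 = 1 * 1], hence all constants. *)
Lemma anchor_cst x (u : A x) (a : R) : rho x u (fun=> a) = 0.
Proof.
have [lin leib] := anchor_tangent an u.
have D1 : rho x u (fun=> 1) = 0.
  have := leib _ _ (@smooth_cst _ M 1) (@smooth_cst _ M 1).
  rewrite (_ : (fun _ : M => 1 * 1) = (fun=> 1)); last by rewrite mulr1.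
  by rewrite !mul1r => /eqP; rewrite -subr_eq subrr eq_sym => /eqP.
have := lin a _ _ (@smooth_cst _ M 1) (@smooth_cst _ M 0).
rewrite (_ : (fun _ : M => a * 1 + 0) = (fun=> a)); last by rewrite mulr1 addr0.
move=> ->; rewrite D1 mulr0 add0r.
have := lin 1 _ _ (@smooth_cst _ M 0) (@smooth_cst _ M 0).
rewrite (_ : (fun _ : M => 1 * 0 + 0) = (fun=> 0)); last by rewrite mul1r addr0.
by rewrite mul1r => /eqP; rewrite -subr_eq subrr eq_sym => /eqP.
Qed.

Lemma app_anchor_smooth s f : smooth_sect s -> smooth f -> smooth (app_anchor rho s f).
Proof.
move=> ss sf; apply: smooth_on_local => x _; have [T AT Tx] := triv_cover A x.
have oT := triv_open AT; exists (tdom T) => //.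
apply: (smooth_on_eq oT (f := fun y => \sum_i tmap T y (s y) 0 i * rho y (frame T i y) f)).
  move=> y Ty; rewrite /app_anchor [in RHS](frame_expand (s y) AT Ty) anchor_sum //.
  by apply: eq_bigr => i _; rewrite anchorZ.
apply: smooth_on_sum => // i; apply: smooth_on_mul => //; first exact: ss.
exact: (anchor_smooth an).
Qed.

Definition gact (s : sections A) (f : smooth_fun M) : smooth_fun M :=
  exist _ _ (app_anchor_smooth (sectv_smooth s) (fval_smooth f)).

Lemma gactE s f x : fval (gact s f) x = rho x (sectv s x) (fval f).
Proof. by []. Qed.

Lemma gactDl s t f : gact (s + t) f = gact s f + gact t f.
Proof. by apply: fval_inj => x; rewrite fvalD !gactE sectvD anchorD //; exact: fval_smooth. Qed.

Lemma gactZl g s f : gact (g *: s) f = g * gact s f.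
Proof. by apply: fval_inj => x; rewrite fvalM !gactE sectvZ anchorZ //; exact: fval_smooth. Qed.

Lemma gactD s f g : gact s (f + g) = gact s f + gact s g.
Proof.
apply: fval_inj => x; rewrite fvalD !gactE.
have [/(_ 1 _ _ (fval_smooth f) (fval_smooth g)) lin _] := anchor_tangent an (sectv s x).
rewrite mul1r in lin; rewrite -lin; congr (rho _ _ _).
by apply/funext => y; rewrite mul1r.
Qed.

Lemma gactN s f : gact s (- f) = - gact s f.
Proof.
have g0 : gact s 0 = 0 by apply: (addrI (gact s 0)); rewrite -gactD !addr0.
by apply: (addrI (gact s f)); rewrite -gactD !subrr g0.
Qed.

Lemma gactM s f g : gact s (f * g) = f * gact s g + g * gact s f.
Proof.
apply: fval_inj => x; rewrite fvalD !fvalM !gactE.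
by have [_ /(_ _ _ (fval_smooth f) (fval_smooth g)) <-] := anchor_tangent an (sectv s x).
Qed.

Lemma gact_cst s a : gact s (sfcst M a) = 0.
Proof. by apply: fval_inj => x; rewrite gactE anchor_cst. Qed.

Lemma d_rhoE f x (v : A x) : smooth f -> (d_rho rho f x : 'Hom(A x, R^o)) v = rho x v f.
Proof.
move=> sf; pose g (u : A x) : R^o := rho x u f.
have gL : linear g by move=> c u1 u2; rewrite /g anchor_linear.
pose G : {linear A x -> R^o} := HB.pack g (GRing.isLinear.Build R _ _ _ g gL).
exact: (lfunE G v).
Qed.

Lemma d_rho_smooth f : smooth f -> smooth_sect (d_rho rho f).
Proof.
move=> sf; apply: smooth_dual_test => s ss.
rewrite (_ : contract _ _ = app_anchor rho s f); first exact: app_anchor_smooth.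
by apply/funext => x; rewrite /contract d_rhoE.
Qed.

Definition gdif (f : smooth_fun M) : sections (dual_bundle A) :=
  exist _ _ (d_rho_smooth (fval_smooth f)).

Lemma pair_gdif f s : pair (gdif f) s = gact s f.
Proof. by apply: fval_inj => x; rewrite pairE d_rhoE //; exact: fval_smooth. Qed.

End Anchor.

Section Algebroid.
Context (R : realType) (M : manifold R) (A : vector_bundle M) (rho : anchor_map A).
Context (br : sect_bracket A).
Context (LA : lie_algebroid rho br).
Arguments rho : clear implicits.
Implicit Types (s t u a : sections A) (f g : smooth_fun M).
Implicit Types (al be : sections (dual_bundle A)).

Let an := la_anchor LA.
Local Notation gact := (gact an).

Definition gbr s t : sections A := exist _ _ (la_smooth LA (sectv_smooth s) (sectv_smooth t)).

Lemma gbrE s t x : sectv (gbr s t) x = br (sectv s) (sectv t) x.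
Proof. by []. Qed.

Lemma gbrC s t : gbr s t = - gbr t s.
Proof.
by apply: sectv_inj => x; rewrite sectvN !gbrE; apply: (la_skew LA); exact: sectv_smooth.
Qed.

Lemma gbrss s : gbr s s = 0.
Proof.
apply: sectv_inj => x; have := congr1 (fun t => sectv t x) (gbrC s s).
rewrite sectvN => /eqP; rewrite -addr_eq0 -mulr2n -scaler_nat scaler_eq0 pnatr_eq0 /=.
by move/eqP.
Qed.

Lemma gbrDr s t u : gbr s (t + u) = gbr s t + gbr s u.
Proof.
apply: sectv_inj => x; rewrite sectvD !gbrE.
have := la_linearr LA 1 (sectv_smooth s) (sectv_smooth t) (sectv_smooth u) x.
rewrite scale1r => <-; suff -> : sectv (t + u) = (fun y => 1 *: sectv t y + sectv u y) by [].
by apply: functional_extensionality_dep => y; rewrite scale1r.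
Qed.

Lemma gbrZr s f t : gbr s (f *: t) = f *: gbr s t + gact s f *: t.
Proof.
apply: sectv_inj => x; rewrite sectvD !sectvZ !gbrE.
have H := la_leibniz LA (sectv_smooth s) (sectv_smooth t) (fval_smooth f).
exact: H.
Qed.

Lemma gbr_jacobi s t u : gbr s (gbr t u) + gbr t (gbr u s) + gbr u (gbr s t) = 0.
Proof.
apply: sectv_inj => x.
have H := la_jacobi LA (sectv_smooth s) (sectv_smooth t) (sectv_smooth u).
exact: H.
Qed.

(** A nonvanishing section detects that the anchor is a morphism, by the Jacobi
    identity for [s], [t] and its multiples; none exists in rank [0]. *)
Lemma gact_gbr s t f : (0 < rank A)%N ->
  gact (gbr s t) f = gact s (gact t f) - gact t (gact s f).
Proof.
move=> rk; apply: fval_inj => x; have [T AT Tx] := triv_cover A x.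
pose v := frame T (Ordinal rk) x; have [u ux] := section_through v.
have v0 : v != 0.
  apply/eqP => v0; have := tmap_frame (Ordinal rk) (Ordinal rk) AT Tx.
  by rewrite -/v v0 linear0 mxE eqxx => /esym/eqP; rewrite oner_eq0.
have J := gbr_jacobi s t (f *: u).
have K := gbr_jacobi s t u.
suff /(congr1 (fun w => sectv w x)) :
    (gact (gbr s t) f - (gact s (gact t f) - gact t (gact s f))) *: u = 0.
  rewrite sectvZ ux => /eqP; rewrite scaler_eq0 (negbTE v0) orbF fvalD fvalN => /eqP.
  by move/eqP; rewrite subr_eq0 => /eqP.
have N a b : gbr a (- b) = - gbr a b.
  have z : gbr a 0 = 0 by apply: (addrI (gbr a 0)); rewrite -gbrDr !addr0.
  by apply: (addrI (gbr a b)); rewrite -gbrDr !subrr z.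
have pN al a : pair al (- a) = - pair al a.
  by rewrite -scaleN1r pairZr mulN1r.
move: J K; rewrite (gbrC (f *: u)) (gbrC (f *: u)) (gbrC u s) (gbrC u) !N.
rewrite (gbrZr t) (gbrZr s f u) !gbrDr !gbrZr => J K.
apply: pair_injr => al; move: (congr1 (pair al) J) (congr1 (pair al) K).
rewrite -(scale0r 0) !(pairDr, pairZr, pN) mul0r => {}J {}K.
have {J K} H := f_equal2 (fun X Y : smooth_fun M => - X + f * Y) J K.
apply: eq_of_subr H _; ring.
Qed.

(** * The Lie derivative of forms *)

(** What [L_a al] should be on a global section. *)
Definition lie_pair (a : sections A) al s : smooth_fun M :=
  gact a (pair al s) - pair al (gbr a s).

Lemma lie_pair_linear a al f s t :
  lie_pair a al (f *: s + t) = f * lie_pair a al s + lie_pair a al t.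
Proof.
rewrite /lie_pair gbrDr gbrZr !(pairDr, pairZr) gactD gactM; ring.
Qed.

(** Any two sections with the same value at [x] give the same result by tensoriality,
    so the choice in the definition of the Lie derivative is harmless. *)
Lemma lie_form_of_form a al s x :
  lie_form rho br (sectv a) (of_form (sectv al)) x [:: sectv s x] = fval (lie_pair a al s) x.
Proof.
rewrite /lie_form; case: xgetP => [_ -> [bs [sbs]]|/(_ (fval (lie_pair a al s) x))[]]; last first.
  exists [:: sectv s]; split=> //; first by case=> // _; exact: sectv_smooth.
  rewrite /lie_form_eval /= big_ord_recl big_ord0 addr0.
  by [].
case: bs sbs => [|b [|]] //= /(_ 0%N isT) sb [bx] ->.
rewrite /lie_form_eval /= big_ord_recl big_ord0 addr0 /=.
have := @tensorial _ _ _ _ (lie_pair_linear a al) s (exist _ b sb) x.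
rewrite /sectv /= bx => ->//.
Qed.

Lemma lie_form1E a al s x :
  (lie_form1 rho br (sectv a) (sectv al) x : 'Hom(A x, R^o)) (sectv s x)
  = fval (lie_pair a al s) x.
Proof.
pose g (v : A x) : R^o := lie_form rho br (sectv a) (of_form (sectv al)) x [:: v].
have gL : linear g.
  move=> c v w; have [[s1 <-] [s2 <-]] := (section_through v, section_through w).
  rewrite /g -[c](_ : fval (sfcst M c) x = c) // -sectvZ -sectvD !lie_form_of_form.
  by rewrite lie_pair_linear.
pose H : {linear A x -> R^o} := HB.pack g (GRing.isLinear.Build R _ _ _ g gL).
by rewrite -lie_form_of_form; exact: (lfunE H (sectv s x)).
Qed.

Lemma lie_form1_smooth a al : smooth_sect (lie_form1 rho br (sectv a) (sectv al)).
Proof.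
apply: smooth_dual_test => s ss.
rewrite (_ : contract _ _ = fval (lie_pair a al (exist _ s ss))); first exact: fval_smooth.
by apply/funext => x; rewrite -lie_form1E.
Qed.

Definition glie (a : sections A) al : sections (dual_bundle A) :=
  exist _ _ (lie_form1_smooth a al).

Lemma pair_glie a al s : pair (glie a al) s = gact a (pair al s) - pair al (gbr a s).
Proof. by apply: fval_inj => x; rewrite pairE lie_form1E. Qed.

Definition algebroid_cartan (rk : (0 < rank A)%N) :
  cartan (sections A) (sections (dual_bundle A)) :=
  Cartan (@pairDl _ _ _) (@pairZl _ _ _) (@pairDr _ _ _) (@pairZr _ _ _)
    (@pair_injl _ _ _) (@pair_injr _ _ _) (gactDl an) (gactZl an) (gactD an) (gactM an)
    gbrDr gbrC gbrss gbrZr gbr_jacobi (fun s t f => gact_gbr s t f rk) pair_glie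
    (pair_gdif an).

End Algebroid.

(** * Alternating bilinear forms *)

(** Rewrites the sum over pairs of basis vectors in the pairing as a double sum. *)
Lemma sum_tuple2 (R : nmodType) (T : finType) (F : 2.-tuple T -> R) :
  \sum_t F t = \sum_i \sum_j F [tuple i; j].
Proof.
rewrite pair_bigA /= (reindex (fun p : T * T => [tuple p.1; p.2])) //=.
exists (fun t : 2.-tuple T => (tnth t ord0, tnth t (lift ord0 ord0))) => [[i j] _ //|t _].
by apply: eq_from_tnth => i; case: (unliftP ord0 i) => [j|] -> //; rewrite (ord1 j).
Qed.

Section Alt2.
Context (R : realType) (V : vectType R) (P : seq V -> R).
Context (altP : alt_form 2 P).

Lemma alt2Dl u v w : P [:: u + v; w] = P [:: u; w] + P [:: v; w].
Proof. by have [_ /(_ [::] [:: w] 1 u v) /= + _] := altP; rewrite scale1r mul1r. Qed.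

Lemma alt2Dr u v w : P [:: w; u + v] = P [:: w; u] + P [:: w; v].
Proof. by have [_ /(_ [:: w] [::] 1 u v) /= + _] := altP; rewrite scale1r mul1r. Qed.

Lemma alt2id u : P [:: u; u] = 0.
Proof. by have [_ _] := altP; apply; rewrite /= inE eqxx. Qed.

Lemma alt2C u v : P [:: u; v] = - P [:: v; u].
Proof.
have := alt2id (u + v); rewrite alt2Dl !alt2Dr !alt2id add0r addr0.
by move/eqP; rewrite addr_eq0 => /eqP.
Qed.

Lemma alt20l w : P [:: 0; w] = 0.
Proof. by apply: (addrI (P [:: 0; w])); rewrite -alt2Dl !addr0. Qed.

Lemma alt2Zl r u w : P [:: r *: u; w] = r * P [:: u; w].
Proof.
by have [_ /(_ [::] [:: w] r u 0) /= + _] := altP; rewrite addr0 alt20l addr0.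
Qed.

Lemma alt2_suml (I : Type) (r : seq I) (c : I -> R) (F : I -> V) w :
  P [:: \sum_(i <- r) c i *: F i; w] = \sum_(i <- r) c i * P [:: F i; w].
Proof.
elim: r => [|i r IH]; first by rewrite !big_nil alt20l.
by rewrite !big_cons alt2Dl alt2Zl IH.
Qed.

Lemma alt2_sumr (I : Type) (r : seq I) (c : I -> R) (F : I -> V) w :
  P [:: w; \sum_(i <- r) c i *: F i] = \sum_(i <- r) c i * P [:: w; F i].
Proof.
by rewrite alt2C alt2_suml -sumrN; apply: eq_bigr => i _; rewrite alt2C mulrN opprK.
Qed.

End Alt2.

Section DualBasis.
Context (R : realType) (V : vectType R).
Implicit Types (al be : 'Hom(V, R^o)).

Let b i : V := tnth (vbasis {:V}) i.
Let c i : 'Hom(V, R^o) := linfun (coord (vbasis {:V}) i).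

Lemma dual_basisE (al : 'Hom(V, R^o)) : al = \sum_i (al (b i) : R) *: c i.
Proof.
apply/lfunP => u; rewrite sum_lfunE {1}(coord_vbasis (memvf u)) linear_sum.
apply: eq_bigr => i _; rewrite scale_lfunE /c lfunE linearZ /= -tnth_nth.
by rewrite /GRing.scale /= mulrC.
Qed.

(** A finite-dimensional space is its own bidual. *)
Lemma alt2_sharp_exists (P : seq 'Hom(V, R^o) -> R) al :
  alt_form 2 P -> exists v, forall be, be v = P [:: al; be].
Proof.
move=> aP; exists (\sum_i P [:: al; c i] *: b i) => be.
rewrite [in RHS](dual_basisE be) alt2_sumr // linear_sum; apply: eq_bigr => i _.
by rewrite linearZ /GRing.scale /= mulrC.
Qed.

(** The sum of two decomposable forms is what a derivation makes of one. *)
Lemma pairing2 (P : seq 'Hom(V, R^o) -> R) (eta : seq V -> R) al be al' be' :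
  alt_form 2 P ->
  (forall u v, eta [:: u; v] = (al u * be v - al v * be u)
     + (al' u * be' v - al' v * be' u)) ->
  pairing 2 P eta = P [:: al; be] + P [:: al'; be'].
Proof.
move=> aP etaE; rewrite /pairing sum_tuple2.
have S x y : P [:: x; y] = \sum_i \sum_j P [:: c i; c j] * (x (b i) * y (b j)).
  rewrite {1}(dual_basisE x) alt2_suml //; apply: eq_bigr => i _.
  rewrite {1}(dual_basisE y) alt2_sumr // mulr_sumr; apply: eq_bigr => j _.
  by rewrite mulrA mulrC.
have D x y : P [:: x; y] *+ 2 =
    \sum_i \sum_j P [:: c i; c j] * (x (b i) * y (b j) - x (b j) * y (b i)).
  rewrite mulr2n {1}S -[P [:: x; y]]opprK -(alt2C aP y x) S.
  rewrite -sumrN -big_split; apply: eq_bigr => i _.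
  rewrite -sumrN -big_split; apply: eq_bigr => j _ /=.
  by rewrite mulrBr (mulrC (y _)).
have -> : \sum_i \sum_j P [:: c i; c j] * eta [:: b i; b j]
    = (P [:: al; be] + P [:: al'; be']) *+ 2.
  rewrite mulrnDl !D -big_split; apply: eq_bigr => i _.
  by rewrite -big_split; apply: eq_bigr => j _; rewrite /= etaE mulrDr.
by rewrite -[_ *+ 2]mulr_natl mulKf // pnatr_eq0.
Qed.

End DualBasis.

(** * Bivector fields *)

Section Bivector.
Context (R : realType) (M : manifold R) (A : vector_bundle M).
Implicit Types (al be : sections (dual_bundle A)) (P : tensor (dual_bundle A)).

(** The form [al /\ be]. *)
Definition form2 al be : tensor A := fun x s =>
  if s is [:: u; v] then
    (sectv al x : 'Hom(A x, R^o)) u * (sectv be x : 'Hom(A x, R^o)) v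
    - (sectv al x : 'Hom(A x, R^o)) v * (sectv be x : 'Hom(A x, R^o)) u
  else 0.
Arguments form2 al be x s : clear implicits.

Lemma is_form2 al be : is_form 2 (form2 al be).
Proof.
split=> [x|T I AT].
  have L (f : 'Hom(A x, R^o)) r u v : f (r *: u + v) = r * f u + f v :> R.
    by rewrite linearP.
  split.
  - by case=> [|u [|v [|]]].
  - case=> [|w [|w' s1]] [|z [|z' s2]] r u v //=; rewrite ?mulr0 ?addr0 //.
    + by rewrite !L; ring.
    + by rewrite !L; ring.
    + by case: s1 => *; rewrite mulr0 addr0.
    + by case: s1 => *; rewrite mulr0 addr0.
    + by case: s1 => *; rewrite mulr0 addr0.
  - case=> [|u [|v [|]]] //=; rewrite !inE !andbT negbK => /eqP <-.
    by rewrite subrr.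
have oT := triv_open AT.
have sm al' i : smooth_on (tdom T) (fun x => (sectv al' x : 'Hom(A x, R^o)) (frame T i x) : R).
  exact: (smooth_dualP _).1 (sectv_smooth al') T i AT.
case: I => [|i [|j [|]]] /= *; try exact: smooth_on_cst.
apply: smooth_on_add => //; first exact: smooth_on_mul.
by apply: smooth_on_opp => //; exact: smooth_on_mul.
Qed.

Section LieMv.
Context (rho : anchor_map A) (br : sect_bracket A) (LA : lie_algebroid rho br).
Arguments rho : clear implicits.

(** [L_a (al /\ be) = L_a al /\ be + al /\ L_a be]. Since the right-hand side is a
    tensor, the choice of sections through [u] and [v] does not matter. *)
Lemma lie_form_form2 (a : sections A) al be x (u v : A x) :
  lie_form rho br (sectv a) (form2 al be) x [:: u; v] =
  ((sectv (glie LA a al) x : 'Hom(A x, R^o)) u * (sectv be x : 'Hom(A x, R^o)) v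
   - (sectv (glie LA a al) x : 'Hom(A x, R^o)) v * (sectv be x : 'Hom(A x, R^o)) u)
  + ((sectv al x : 'Hom(A x, R^o)) u * (sectv (glie LA a be) x : 'Hom(A x, R^o)) v
   - (sectv al x : 'Hom(A x, R^o)) v * (sectv (glie LA a be) x : 'Hom(A x, R^o)) u).
Proof.
have evalE (s t : sections A) :
    lie_form_eval rho br (sectv a) (form2 al be) [:: sectv s; sectv t] x =
    fval (pair (glie LA a al) s * pair be t - pair (glie LA a al) t * pair be s
      + (pair al s * pair (glie LA a be) t - pair al t * pair (glie LA a be) s)) x.
  have <- : gact (la_anchor LA) a (pair al s * pair be t - pair al t * pair be s)
      - ((pair al (gbr LA a s) * pair be t - pair al t * pair be (gbr LA a s))
      + (pair al s * pair be (gbr LA a t) - pair al (gbr LA a t) * pair be s))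
    = pair (glie LA a al) s * pair be t - pair (glie LA a al) t * pair be s
      + (pair al s * pair (glie LA a be) t - pair al t * pair (glie LA a be) s).
    by rewrite !pair_glie gactD gactN !gactM; ring.
  by rewrite /lie_form_eval /= !big_ord_recl big_ord0 /= addr0.
have [[s su] [t tv]] := (section_through u, section_through v).
rewrite /lie_form; set S := mkset _; set rhs := (X in _ = X).
have SE r : S r -> r = rhs.
  case=> -[|b1 [|b2 [|b3 bs]]] [sm] //= [e1 e2] ->.
  have e1' : sectv (exist _ b1 (sm 0%N isT)) x = u by exact: e1.
  have e2' : sectv (exist _ b2 (sm 1%N isT)) x = v by exact: e2.
  by rewrite (evalE (exist _ b1 (sm 0%N isT)) (exist _ b2 (sm 1%N isT))) !(fvalE, pairE) e1' e2'.
case: xgetP => [_ -> /SE -> //|/(_ (lie_form_eval rho br (sectv a) (form2 al be) [:: sectv s; sectv t] x))[]].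
exists [:: sectv s; sectv t]; split=> //=; last by rewrite su tv.
by move=> [|[|]] // _; exact: sectv_smooth.
Qed.

(** A Lie derivative of multivector fields, specified by its pairings with all
    forms, is determined by its pairings with the decomposable ones. *)
Lemma lie_mv_biv (a : sections A) (P P' : tensor (dual_bundle A)) al be x :
  is_form 2 P -> alt_form 2 (P' x) -> is_lie_mv rho br 2 (sectv a) P P' ->
  P' x [:: sectv al x; sectv be x] =
  rho x (sectv a x) (fun y => P y [:: sectv al y; sectv be y])
  - (P x [:: sectv (glie LA a al) x; sectv be x]
     + P x [:: sectv al x; sectv (glie LA a be) x]).
Proof.
move=> [altP _] altP' /(_ _ (is_form2 al be) x).
have pE (Q : tensor (dual_bundle A)) y : alt_form 2 (Q y) ->
    pairing 2 (Q y) (form2 al be y) = Q y [:: sectv al y; sectv be y].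
  move=> aQ; rewrite (@pairing2 _ _ _ _ (sectv al y) (sectv be y) 0 0 aQ) ?alt20l ?addr0 //.
  by move=> u v; rewrite !lfunE /= !mul0r subrr addr0.
rewrite pE // => ->; congr (_ - _).
  by congr (rho _ _ _); apply/funext => y; rewrite pE.
by rewrite (pairing2 (altP x) (@lie_form_form2 a al be x)).
Qed.

End LieMv.

(** * The bundle map of a bivector field *)

Section Sharp.
Context (P : tensor (dual_bundle A)) (fP : is_form 2 P).
Arguments P : clear implicits.

Lemma sharpP x (u v : dual_bundle A x) :
  (v : 'Hom(A x, R^o)) (sharp P u) = P x [:: u; v].
Proof.
rewrite /sharp; case: xgetP => [w _ /(_ v) //|].
have [w wP] := alt2_sharp_exists u (fP.1 x).
by move=> /(_ w).
Qed.

Lemma sharp_sect_smooth (al : sect (dual_bundle A)) :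
  smooth_sect al -> smooth_sect (sharp_sect P al).
Proof.
move=> sal T j AT; have oT := triv_open AT.
have AdT : trivs (dual_triv T : triv (rank (dual_bundle A)) (dual_bundle A)) by exists T.
apply: (smooth_on_eq oT (f := fun x => \sum_i tmap (dual_triv T) x (al x) 0 i *
    P x [seq frame (dual_triv T) k x | k <- [:: i; j]])).
  move=> x Tx; rewrite -(dual_frameE T j) sharpP.
  rewrite [in RHS](frame_expand (al x : dual_bundle A x) AdT Tx) alt2_suml //.
  exact: fP.1.
apply: smooth_on_sum => // i; apply: smooth_on_mul => //.
  exact: sal i AdT.
exact: fP.2 _ _ AdT.
Qed.

Definition gsharp al : sections A := exist _ _ (sharp_sect_smooth (sectv_smooth al)).

Lemma pair_gsharp al be x : fval (pair be (gsharp al)) x = P x [:: sectv al x; sectv be x].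
Proof. by rewrite pairE sharpP. Qed.

Lemma gsharp_skew al be : pair be (gsharp al) = - pair al (gsharp be).
Proof. by apply: fval_inj => x; rewrite fvalN !pair_gsharp (alt2C (fP.1 x)). Qed.

End Sharp.

End Bivector.

(** * Exterior products *)

Section Wedge.
Context (R : realType) (M : manifold R) (E : vector_bundle M).
Implicit Types (P Q : tensor E) (f : M -> R).

(** The two parts of a splitting of [s] have total length [size s]. *)
Lemma big_unshuffles_size (V : Type) (s : seq V) (F : bool * seq V * seq V -> R) :
  (forall p, (size p.1.2 + size p.2 = size s)%N -> F p = 0) ->
  \sum_(p <- unshuffles s) F p = 0.
Proof.
elim: s F => [|v s IH] F F0 /=; first by rewrite big_seq1 F0.
by rewrite big_cat !big_map /= !IH ?addr0 // => p ps; apply: F0; rewrite /= ?addnS ?addSn ps.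
Qed.

(** Only one splitting of [s] has an empty first part. *)
Lemma big_unshuffles0 (V : Type) (s : seq V) (F : bool * seq V * seq V -> R) :
  (forall p, p.1.2 <> [::] -> F p = 0) ->
  \sum_(p <- unshuffles s) F p = F (false, [::], s).
Proof.
elim: s F => [|v s IH] F F0 /=; first by rewrite big_seq1.
rewrite big_cat !big_map /= big1 ?add0r => [|p _]; last exact: F0.
by rewrite (IH (fun p => F (p.1.1 (+) odd (size p.1.2), p.1.2, v :: p.2))) //= => p p0; exact: F0.
Qed.

Lemma wedge_fun f P x s : wedge (of_fun f) P x s = f x * P x s.
Proof.
rewrite /wedge big_unshuffles0 /= ?expr0 ?mul1r // => p.
by case: p.1.2 => // *; rewrite mulr0 mul0r.
Qed.

Lemma is_form_of_fun f : smooth f -> is_form 0 (of_fun f : tensor E).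
Proof.
move=> sf; split=> [x|T [|i I] AT /=]; last first.
- exact: smooth_on_cst.
- exact: smooth_restrict.
split.
- by case.
- by case=> [|? ?] *; rewrite mulr0 addr0.
- by case.
Qed.

Lemma is_form_lin k (r : R) P Q :
  is_form k P -> is_form k Q -> is_form k (fun x s => r * P x s + Q x s).
Proof.
move=> [aP sP] [aQ sQ]; split=> [x|T I AT].
  have [P1 P2 P3] := aP x; have [Q1 Q2 Q3] := aQ x; split=> [s sk|s1 s2 c u v|s us].
  - by rewrite P1 // Q1 // mulr0 addr0.
  - by rewrite P2 Q2; ring.
  - by rewrite P3 // Q3 // mulr0 addr0.
have oT := triv_open AT; apply: smooth_on_add => //; last exact: sQ.
by apply: smooth_on_mul => //; [exact: smooth_on_cst|exact: sP].
Qed.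

Lemma is_form0 k : @is_form R M E k (fun _ _ => 0).
Proof.
split=> [x|*]; last exact: smooth_on_cst.
by split=> // *; rewrite mulr0 addr0.
Qed.

Lemma is_form_fun_mul k f P : smooth f -> is_form k P -> is_form k (wedge (of_fun f) P).
Proof.
move=> sf [aP sP]; have -> : wedge (of_fun f) P = (fun x s => f x * P x s).
  by apply: functional_extensionality_dep => x; apply/funext => s; rewrite wedge_fun.
split=> [x|T I AT].
  have [P1 P2 P3] := aP x; split=> [s sk|s1 s2 c u v|s us].
  - by rewrite P1 // mulr0.
  - by rewrite P2; ring.
  - by rewrite P3 // mulr0.
by apply: smooth_on_mul; [exact: triv_open|exact: smooth_restrict|exact: sP].
Qed.

Lemma is_form_sum k (I : Type) (r : seq I) (Q : I -> tensor E) :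
  (forall i, is_form k (Q i)) -> is_form k (fun x s => \sum_(i <- r) Q i x s).
Proof.
move=> fQ; elim: r => [|i r IH].
  have -> : (fun x s => \sum_(i <- [::]) Q i x s) = (fun _ _ => 0) :> tensor E.
    by apply: functional_extensionality_dep => x; apply/funext => s; rewrite big_nil.
  exact: is_form0.
have -> : (fun x s => \sum_(j <- i :: r) Q j x s) =
    (fun x s => 1 * Q i x s + \sum_(j <- r) Q j x s) :> tensor E.
  by apply: functional_extensionality_dep => x; apply/funext => s; rewrite big_cons mul1r.
exact: is_form_lin.
Qed.

Lemma wedge_vanishl P Q x s : (forall s, P x s = 0) -> wedge P Q x s = 0.
Proof. by move=> P0; rewrite /wedge big1 // => p _; rewrite P0 mulr0 mul0r. Qed.

Lemma wedge_vanishr P Q x s : (forall s, Q x s = 0) -> wedge P Q x s = 0.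
Proof. by move=> Q0; rewrite /wedge big1 // => p _; rewrite Q0 mulr0. Qed.

End Wedge.

Section WedgeSect.
Context (R : realType) (M : manifold R) (A : vector_bundle M).
Implicit Types (a b : sections A) (al be : sections (dual_bundle A)).
Implicit Types (Q : tensor (dual_bundle A)).

Lemma wedge_sectE a b x (u v : dual_bundle A x) :
  wedge (of_sect (sectv a)) (of_sect (sectv b)) x [:: u; v]
  = (u : 'Hom(A x, R^o)) (sectv a x) * (v : 'Hom(A x, R^o)) (sectv b x)
    - (v : 'Hom(A x, R^o)) (sectv a x) * (u : 'Hom(A x, R^o)) (sectv b x).
Proof.
rewrite /wedge /= !big_cons big_nil /= !expr0 !expr1.
by rewrite !(mulr0, mul0r, mul1r, mulN1r, addr0, add0r, mulNr).
Qed.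

Lemma wedge_sect_size a b x s : size s <> 2 ->
  wedge (of_sect (sectv a)) (of_sect (sectv b)) x s = 0.
Proof.
move=> s2; apply: big_unshuffles_size => -[[c s1] t] /=.
case: s1 => [|u [|u' s1]]; rewrite ?mulr0 ?mul0r // => e.
by case: t e => [|v [|v' t]] e; rewrite /= ?mulr0 //; case: s2.
Qed.

Lemma wedge_sectr Q b x (u v w : dual_bundle A x) : alt_form 2 (Q x) ->
  wedge Q (of_sect (sectv b)) x [:: u; v; w] =
    Q x [:: u; v] * (w : 'Hom(A x, R^o)) (sectv b x)
    - Q x [:: u; w] * (v : 'Hom(A x, R^o)) (sectv b x)
    + Q x [:: v; w] * (u : 'Hom(A x, R^o)) (sectv b x).
Proof.
case=> Q2 _ _; rewrite /wedge /= !big_cons big_nil /=.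
rewrite (Q2 [::]) // (Q2 [:: u; v; w]) // (Q2 [:: u]) // (Q2 [:: v]) // (Q2 [:: w]) //.
by rewrite !expr0 !expr1; ring.
Qed.

End WedgeSect.

Lemma tensor_ext (R : realType) (M : manifold R) (E : vector_bundle M) (P Q : tensor E) :
  (forall x s, P x s = Q x s) -> P = Q.
Proof.
by move=> PQ; apply: functional_extensionality_dep => x; apply/funext => s; exact: PQ.
Qed.

Lemma is_form_of_sect (R : realType) (M : manifold R) (A : vector_bundle M) (a : sections A) :
  is_form 1 (of_sect (sectv a)).
Proof.
split=> [x|T I [T0 AT <-]].
  split; first by case=> [|u [|v s]].
  - case=> [|w [|w' s1]] [|z s2] r u v //=; rewrite ?mulr0 ?addr0 //.
    by rewrite add_lfunE scale_lfunE.
  - by case=> [|u [|v s]].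
case: I => [|i [|j I]] /=; try exact: smooth_on_cst.
apply: (smooth_on_eq (triv_open AT)) (sectv_smooth a i AT) => x _.
by rewrite dual_frameE.
Qed.

Lemma is_form_wedge_sect (R : realType) (M : manifold R) (A : vector_bundle M)
    (a b : sections A) : is_form 2 (wedge (of_sect (sectv a)) (of_sect (sectv b))).
Proof.
have sz := @wedge_sect_size R M A a b.
split=> [x|T I AT].
  split; first exact: sz.
  - case=> [|w [|w' s1]] [|z [|z' s2]] r u v; rewrite ?wedge_sectE;
      try by rewrite !sz ?mulr0 ?addr0 //= => -[]; rewrite ?size_cat ?addnS.
    + by rewrite !(add_lfunE, scale_lfunE) /GRing.scale /=; ring.
    + by rewrite !(add_lfunE, scale_lfunE) /GRing.scale /=; ring.
  - case=> [|u [|v [|w s]]] //= us; try by rewrite sz.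
    move: us; rewrite wedge_sectE inE andbT negbK => /eqP <-.
    by rewrite mulrC subrr.
have oT := triv_open AT.
case: I => [|i [|j [|k I]]];
  try by (apply: (smooth_on_eq oT) (smooth_on_cst _ 0) => x _; rewrite sz).
apply: (smooth_on_eq oT) => [x _|]; first by rewrite /= wedge_sectE.
case: AT => T0 AT0 TE.
have fs (s : sections A) k : smooth_on (tdom T)
    (fun x => (frame T k x : 'Hom(A x, R^o)) (sectv s x) : R).
  rewrite -TE; apply: (smooth_on_eq (triv_open AT0)) (sectv_smooth s k AT0) => x _.
  by rewrite dual_frameE.
apply: smooth_on_add => //; first exact: smooth_on_mul.
by apply: smooth_on_opp => //; exact: smooth_on_mul.
Qed.

(** * The Schouten bracket of a bivector with itself *)

Section Schouten.
Context (R : realType) (M : manifold R) (A : vector_bundle M).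
Context (rho : anchor_map A) (br : sect_bracket A) (LA : lie_algebroid rho br).
Context (rk : (0 < rank A)%N).
Context (Pi : tensor (dual_bundle A)) (fP : is_form 2 Pi).
Arguments Pi : clear implicits.
Arguments rho : clear implicits.
Implicit Types (a b : sections A) (al be ga : sections (dual_bundle A)).

Let C := algebroid_cartan LA rk.
Let p := gsharp fP.

Let evCE al s : ev C al s = pair al s. Proof. by []. Qed.

Lemma lie_mv_lie_biv a (P' : tensor (dual_bundle A)) al be x :
  alt_form 2 (P' x) -> is_lie_mv rho br 2 (sectv a) Pi P' ->
  P' x [:: sectv al x; sectv be x] = fval (lie_biv C a p al be) x.
Proof.
move=> aP' L; rewrite (lie_mv_biv LA al be fP aP' L) /lie_biv !fvalE.
rewrite [fval (ev C be (p _)) x]pair_gsharp [fval (ev C _ (p al)) x]pair_gsharp.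
rewrite opprD addrA; congr (_ - _ - _).
rewrite [RHS]gactE; congr (rho x _ _).
by apply/funext => y; rewrite -pair_gsharp.
Qed.

(** In dual frames [2 Pi = sum_i e_i /\ # eps_i]; the global frame at [x] adds
    the error term [h^2 Pi]. *)
Lemma sharp_decomp x : exists h : smooth_fun M,
  exists a b : 'I_(rank A) -> sections A, fval h x = 0 /\
  forall al, p al = (h * h) *: p al + \sum_i wedge2 C (a i) (b i) al.
Proof.
have [h [e [eps [hx hE]]]] := pair_frame A x.
pose half : smooth_fun M := sfcst M (2^-1).
exists h, (fun i => half *: e i), (fun i => p (eps i)); split=> // al.
apply: pair_injr => be.
have sumE (I : Type) (r : seq I) (F : I -> sections A) g :
    pair g (\sum_(i <- r) F i) = \sum_(i <- r) pair g (F i).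
  elim: r => [|i r IH]; last by rewrite !big_cons pairDr IH.
  by rewrite !big_nil -(scale0r 0) pairZr mul0r.
have hal g s : \sum_i pair g (e i) * pair (eps i) s = (1 - h * h) * pair g s.
  have := congr1 (pair g) (hE s); rewrite pairDr pairZr sumE => E.
  rewrite mulrBl mul1r {1}E addrC addKr.
  by apply: eq_bigr => i _; rewrite pairZr mulrC.
have half2 : half + half = 1.
  by apply: fval_inj => y; rewrite fvalD /fval /=; lra.
rewrite pairDr pairZr sumE.
transitivity ((h * h) * pair be (p al) +
    half * (\sum_i pair be (e i) * pair (eps i) (p al) -
            \sum_i pair al (e i) * pair (eps i) (p be))).
  rewrite !hal [pair al (p be)]gsharp_skew mulrN opprK -mulr2n -mulr_natr mulrCA.
  have -> : half * 2%:R = 1 by rewrite mulr_natr mulr2n.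
  by ring.
congr (_ + _); rewrite mulrBr !mulr_sumr -sumrB; apply: eq_bigr => i _.
rewrite /wedge2 !evCE pairDr -[X in _ = _ + pair be X]scaleN1r !pairZr mulN1r.
rewrite [pair be (p (eps i))]gsharp_skew [pair al (p (eps i))]gsharp_skew.
by ring.
Qed.

Lemma bivector_decomp (h : smooth_fun M) (a b : 'I_(rank A) -> sections A) :
  (forall al, p al = (h * h) *: p al + \sum_i wedge2 C (a i) (b i) al) ->
  Pi = (fun y s => 1 * wedge (of_fun (fval h)) (wedge (of_fun (fval h)) Pi) y s
    + \sum_i wedge (of_sect (sectv (a i))) (of_sect (sectv (b i))) y s).
Proof.
move=> dec; apply: tensor_ext => y s; rewrite mul1r !wedge_fun.
have [s2|s2] := eqVneq (size s) 2; last first.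
  have [P0 _ _] := fP.1 y; rewrite P0; last exact/eqP.
  rewrite !mulr0 add0r big1 // => i _; apply: wedge_sect_size; exact/eqP.
case: s s2 => [|u [|v [|]]] // _.
have [[al <-] [be <-]] := (section_through u, section_through v).
rewrite -(pair_gsharp fP) -/p {1}dec pairDr pairZr fvalD !fvalM mulrA; congr (_ + _).
rewrite pairE sectv_sum linear_sum; apply: eq_bigr => i _.
by rewrite wedge_sectE -[LHS]pairE /wedge2 !evCE -scaleN1r pairDr !pairZr !(fvalE, pairE); ring.
Qed.

Section Bracket.
Context (S : tensor (dual_bundle A) -> tensor (dual_bundle A) -> tensor (dual_bundle A)).
Context (SN : schouten rho br S).
Arguments S : clear implicits.

(** Additivity alone forces the bracket with [0] to vanish, as [0 = - 0 + 0]. *)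
Lemma sn_sum (I : Type) (r : seq I) (Q : I -> tensor (dual_bundle A)) x s :
  (forall i, is_form 2 (Q i)) ->
  S Pi (fun y t => \sum_(i <- r) Q i y t) x s = \sum_(i <- r) S Pi (Q i) x s.
Proof.
move=> fQ; elim: r => [|i r IH].
  rewrite big_nil (_ : (fun y t => _) = (fun y t => -1 * 0 + 0)).
    rewrite (sn_linearr SN (-1) fP (is_form0 _ 2) (is_form0 _ 2)).
    by rewrite mulN1r addNr.
  by apply: tensor_ext => y t; rewrite big_nil mulr0 addr0.
rewrite big_cons -IH -[S Pi (Q i) x s]mul1r.
have := sn_linearr SN 1 fP (fQ i) (is_form_sum r fQ).
move=> /(congr1 (fun T : tensor (dual_bundle A) => T x s)) <-.
congr (S Pi _ x s); apply: tensor_ext => y t.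
by rewrite big_cons mul1r.
Qed.

(** The Leibniz rule and [[a, Pi] = L_a Pi] determine the bracket with a decomposable
    bivector; the signs are those of the formula for [schouten_biv]. *)
Lemma sn_wedge_sect a b al be ga x :
  S Pi (wedge (of_sect (sectv a)) (of_sect (sectv b))) x
    [:: sectv al x; sectv be x; sectv ga x]
  = fval (schouten_biv C p (wedge2 C a b) al be ga) x.
Proof.
have fS c : is_form 2 (S (of_sect (sectv c)) Pi).
  exact: (sn_degree SN (is_form_of_sect c) fP isT).
have SE c : S Pi (of_sect (sectv c)) = S (of_sect (sectv c)) Pi.
  rewrite (sn_sym SN fP (is_form_of_sect c)); apply: tensor_ext => y s.
  by rewrite expr2 mulrNN mulr1 mul1r.
have L c al' be' : S (of_sect (sectv c)) Pi x [:: sectv al' x; sectv be' x]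
    = fval (lie_biv C c p al' be') x.
  have H := sn_sect SN (sectv_smooth c) fP.
  by apply: lie_mv_lie_biv H; exact: (fS c).1.
rewrite (sn_leibniz SN fP (is_form_of_sect a) (is_form_of_sect b)) !SE.
rewrite wedge_sectr ?wedge_sect2 //; last exact: (fS a).1.
rewrite schouten_biv_wedge2; last exact: gsharp_skew.
rewrite (alt2C ((fS b).1 x) (sectv ga x)) !L !fvalE.
by rewrite !evCE !pairE; ring.
Qed.

(** Both sides are additive in the second [Pi] and vanish at [x] on [h^2 Pi], so the
    decomposition of [Pi] reduces the claim to the bivectors [a i /\ b i]. *)
Lemma sn_biv al be ga x :
  S Pi Pi x [:: sectv al x; sectv be x; sectv ga x]
  = fval (schouten_biv C p p al be ga) x.
Proof.
have [h [a [b [hx dec]]]] := sharp_decomp x.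
have fh := fval_smooth h.
have fhP := is_form_fun_mul fh fP.
have fab i := is_form_wedge_sect (a i) (b i).
rewrite [X in S _ X](bivector_decomp dec).
rewrite (sn_linearr SN 1 fP (is_form_fun_mul fh fhP) (is_form_sum _ fab)) mul1r sn_sum //.
rewrite (sn_leibniz SN fP (is_form_of_fun _ fh) fhP).
(* [h] occurs in each of the two terms of the Leibniz rule for [h (h Pi)]. *)
have h0 s : of_fun (fval h) x s = 0 :> R by case: s.
rewrite wedge_vanishr => [|s]; last exact: wedge_vanishl.
rewrite (wedge_vanishl _ (P := of_fun _)) // mulr0 !add0r.
rewrite (eq_bigr _ (fun i _ => sn_wedge_sect (a i) (b i) al be ga x)) -fval_sum.
have sumT (r : seq 'I_(rank A)) :
    schouten_biv C p (fun al => \sum_(i <- r) wedge2 C (a i) (b i) al) al be ga =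
    \sum_(i <- r) schouten_biv C p (wedge2 C (a i) (b i)) al be ga.
  elim: r => [|i r IH].
    have -> : (fun al' => \sum_(i <- [::]) wedge2 C (a i) (b i) al') = (fun=> 0).
      by apply/funext => al'; rewrite big_nil.
    by rewrite schouten_biv0r big_nil.
  have -> : (fun al' => \sum_(j <- i :: r) wedge2 C (a j) (b j) al') =
      (fun al' => wedge2 C (a i) (b i) al' + \sum_(j <- r) wedge2 C (a j) (b j) al').
    by apply/funext => al'; rewrite big_cons.
  by rewrite schouten_bivDr IH big_cons.
have pE : p = (fun al' => (h * h) *: p al' + \sum_i wedge2 C (a i) (b i) al').
  by apply/funext => al'; rewrite -dec.
rewrite (congr1 (fun q => schouten_biv C p q al be ga) pE) schouten_bivDr sumT.
rewrite schouten_biv_scale; last exact: gsharp_skew.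
by rewrite fvalD fvalM hx mul0r add0r.
Qed.

End Bracket.

Lemma jacobi_structure_pair (xi : sections A) :
  jacobi_structure rho br Pi (sectv xi) -> jacobi_pair C p xi.
Proof.
case=> _ sxi [S SN Sxi] Lxi; split.
- exact: gsharp_skew.
- move=> al be; apply: fval_inj => x; rewrite -(lie_mv_lie_biv _ _ _ Lxi) //.
  by have [] := is_form0 (dual_bundle A) 2.
- move=> al be ga; apply: fval_inj => x.
  have := sn_biv SN al be ga x; rewrite Sxi wedge_sect2 // schouten_biv_diag fvalD.
  set X := (X in fval X x) => E; rewrite -[LHS]/(fval X x); move: (fval X x) E => y E.
  by rewrite !(fvalM, fvalD) !evCE !(pair_gsharp fP) !pairE; move: E; lra.
Qed.

End Schouten.

(** * The Lie algebroid on the dual bundle *)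

Lemma dual_separates (R : realType) (V : vectType R) (u v : V) :
  (forall be : 'Hom(V, R^o), be u = be v) -> u = v.
Proof.
move=> uv; rewrite (coord_vbasis (memvf u)) (coord_vbasis (memvf v)).
apply: eq_bigr => i _; congr (_ *: _).
by have := uv (linfun (coord (vbasis {:V}) i)); rewrite !lfunE.
Qed.

Section JacobiAlgebroid.
Context (R : realType) (M : manifold R) (A : vector_bundle M).
Context (rho : anchor_map A) (br : sect_bracket A) (LA : lie_algebroid rho br).
Context (Pi : tensor (dual_bundle A)) (fP : is_form 2 Pi) (xi : sections A).
Context (lam : sections (dual_bundle A)).
Arguments rho : clear implicits.
Arguments Pi : clear implicits.
Implicit Types (al be : sections (dual_bundle A)) (f : smooth_fun M).

Let an := la_anchor LA.

Lemma sharp_linear x r (u v : dual_bundle A x) :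
  sharp Pi (r *: u + v) = r *: sharp Pi u + sharp Pi v.
Proof.
apply: dual_separates => be; have aP := fP.1 x.
by rewrite linearD linearZ /= !(sharpP fP) (alt2Dl aP) (alt2Zl aP).
Qed.

Lemma sharp_jacobi_linear x r (u v : dual_bundle A x) :
  sharp_jacobi Pi (sectv xi) (r *: u + v) =
  r *: sharp_jacobi Pi (sectv xi) u + sharp_jacobi Pi (sectv xi) v.
Proof.
rewrite /sharp_jacobi sharp_linear add_lfunE scale_lfunE scalerDl scalerDr.
by rewrite -scalerA addrACA.
Qed.

Lemma is_anchor_jacobi : is_anchor (anchor_jacobi rho Pi (sectv xi)).
Proof.
split=> [x u|x r u v f sf|T i f [T0 AT TE] sf].
- by have := anchor_tangent an (sharp_jacobi Pi (sectv xi) u).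
- by rewrite /anchor_jacobi sharp_jacobi_linear (anchor_linear an).
have oT : open (tdom T) by rewrite -TE; exact: triv_open AT.
have AT' : trivs (T : triv (rank (dual_bundle A)) (dual_bundle A)) by exists T0.
apply: (smooth_on_eq oT (f := fun x =>
    \sum_j Pi x [seq frame T k x | k <- [:: i; j]] * rho x (frame T0 j x) f
    + (frame T i x : 'Hom(A x, R^o)) (sectv xi x) * app_anchor rho (sectv xi) f x)).
  move=> x Tx; rewrite /anchor_jacobi /sharp_jacobi (anchorD an) // (anchorZ an) //.
  congr (_ + _); have T0x : tdom T0 x by rewrite -TE in Tx.
  rewrite [in RHS](frame_expand (sharp Pi _) AT T0x) (anchor_sum an) //.
  apply: eq_bigr => j _; rewrite (anchorZ an) // -dual_frameE (sharpP fP).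
  by rewrite -TE.
apply: smooth_on_add => //.
  apply: smooth_on_sum => // j; apply: smooth_on_mul => //; first exact: fP.2 AT'.
  by rewrite -TE; exact: (anchor_smooth an).
apply: smooth_on_mul => //.
  rewrite -TE; apply: (smooth_on_eq (triv_open AT)) (sectv_smooth xi i AT) => x _.
  by rewrite dual_frameE.
apply: smooth_restrict; exact: app_anchor_smooth an _ _ (sectv_smooth xi) sf.
Qed.

Definition gbrj al be : sections (dual_bundle A) :=
  glie LA (gsharp fP al) be - glie LA (gsharp fP be) al
  - gdif an (pair be (gsharp fP al))
  + pair al xi *: (glie LA xi be - be) - pair be xi *: (glie LA xi al - al)
  - pair be (gsharp fP al) *: lam.

Lemma bracket_jacobiE al be :
  bracket_jacobi rho br Pi (sectv xi) (sectv lam) (sectv al) (sectv be) = sectv (gbrj al be).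
Proof.
have bE : biv Pi (sectv al) (sectv be) = fval (pair be (gsharp fP al)).
  by apply/funext => y; rewrite pair_gsharp.
apply: functional_extensionality_dep => x.
by rewrite /bracket_jacobi /koszul bE.
Qed.

Lemma gbrjE (rk : (0 < rank A)%N) :
  gbrj = brj (algebroid_cartan LA rk) (gsharp fP) xi lam.
Proof. by []. Qed.

Lemma rank0_fiber (E : vector_bundle M) x (v : E x) : rank E = 0%N -> v = 0.
Proof.
move=> rk; have [T AT Tx] := triv_cover E x.
rewrite (frame_expand v AT Tx) big1 // => i; by have := ltn_ord i; rewrite {2}rk.
Qed.

(** Linearity over the constants is a case of the Leibniz rule, since the anchor kills
    constants. *)
Lemma lie_algebroid_jacobi :
  jacobi_structure rho br Pi (sectv xi) ->
  (forall al, glie LA xi al = gbrj lam al) ->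
  lie_algebroid (anchor_jacobi rho Pi (sectv xi))
    (bracket_jacobi rho br Pi (sectv xi) (sectv lam)).
Proof.
move=> JS lamP; set brk := bracket_jacobi _ _ _ _ _.
have liftP (s : sect (dual_bundle A)) : smooth_sect s -> exists al, s = sectv al.
  by move=> ss; exists (exist _ s ss).
(* The anchor of [A] is known to be a morphism in positive rank only. *)
have [rk0|rk0] := posnP (rank A).
  have tr x (u v : dual_bundle A x) : u = v.
    by rewrite [u]rank0_fiber // [v]rank0_fiber.
  split; try by move=> *; exact: tr.
    exact: is_anchor_jacobi.
  move=> _ _ /liftP[al ->] /liftP[be ->]; rewrite /brk bracket_jacobiE.
  exact: sectv_smooth.
have JP := @jacobi_structure_pair _ _ _ _ _ LA rk0 _ fP _ JS.
have lamP' al : lie (algebroid_cartan LA rk0) xi al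
    = brj (algebroid_cartan LA rk0) (gsharp fP) xi lam lam al by exact: lamP.
have linr r al be ga : gbrj al (sfcst M r *: be + ga) = sfcst M r *: gbrj al be + gbrj al ga.
  rewrite (gbrjE rk0) (brjD lam JP) (brjZ lam JP).
  by rewrite [act _ _ _](gact_cst an) scale0r addr0.
have skew al be : gbrj al be = - gbrj be al.
  by rewrite (gbrjE rk0); exact: brjC lam JP al be.
split.
- exact: is_anchor_jacobi.
- move=> _ _ /liftP[al ->] /liftP[be ->]; rewrite /brk bracket_jacobiE.
  exact: sectv_smooth.
- move=> r _ _ _ /liftP[al ->] /liftP[be ->] /liftP[ga ->] x.
  rewrite -[fun y => _]/(sectv (sfcst M r *: al + be)) /brk !bracket_jacobiE.
  rewrite skew linr opprD -scalerN -!skew.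
  by [].
- move=> r _ _ _ /liftP[al ->] /liftP[be ->] /liftP[ga ->] x.
  rewrite -[fun y => _]/(sectv (sfcst M r *: be + ga)) /brk !bracket_jacobiE.
  by rewrite linr.
- move=> _ _ /liftP[al ->] /liftP[be ->] x.
  by rewrite /brk !bracket_jacobiE skew.
- move=> _ _ f /liftP[al ->] /liftP[be ->] sf x.
  pose g : smooth_fun M := exist _ f sf.
  rewrite -[fun y => _]/(sectv (g *: be)) /brk !bracket_jacobiE (gbrjE rk0).
  by rewrite (brjZ lam JP).
- move=> _ _ _ /liftP[al ->] /liftP[be ->] /liftP[ga ->] x.
  rewrite /brk !bracket_jacobiE -!sectvD (gbrjE rk0).
  by rewrite (brj_jacobi JP).
Qed.

End JacobiAlgebroid.

Unset Implicit Arguments.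

Theorem corollary3p4 (R : realType) (M : manifold R) (A : vector_bundle M)
    (rho : anchor_map A) (br : sect_bracket A)
    (Pi : tensor (dual_bundle A)) (xi : sect A) (lam : sect (dual_bundle A)) :
  lie_algebroid rho br ->
  jacobi_structure rho br Pi xi ->
  smooth_sect lam ->
  (forall al : sect (dual_bundle A), smooth_sect al -> forall x : M,
     lie_form1 rho br xi al x = bracket_jacobi rho br Pi xi lam lam al x) ->
  lie_algebroid (anchor_jacobi rho Pi xi) (bracket_jacobi rho br Pi xi lam).
Proof.
move=> LA JS slam lamP; have [fP sxi _ _] := JS.
apply: (@lie_algebroid_jacobi R M A rho br LA Pi fP (exist _ xi sxi) (exist _ lam slam) JS).
move=> al; apply: sectv_inj => x; rewrite -bracket_jacobiE.
exact: lamP (sectv_smooth al) x.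
Qed.
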